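(* Let $\alpha\models n$ be compatible with $\sigma\in\mathfrak{S}_{\ell(\alpha)}$. For an arbitrary class $E\in\mathcal{E}^\sigma(\alpha)$, $\overline{\mathbf{P}}_{\boldsymbol{\alpha}_E}$ is the projective cover of the $H_n(0)$-module $\mathbf{S}^\sigma_{\alpha,E}$.
   Context: The $0$-Hecke algebra $H_n(0)$ is the $\mathbb{C}$-algebra generated by $\pi_1,\dots,\pi_{n-1}$ with relations $\pi_i^2=\pi_i$, $\pi_i\pi_{i+1}\pi_i=\pi_{i+1}\pi_i\pi_{i+1}$, $\pi_i\pi_j=\pi_j\pi_i$ for $|i-j|\ge 2$. For a filling, $s_i\cdot(\,)$ denotes swapping the entries $i$ and $i+1$. A projective cover of a finitely generated module $A$ is an essential epimorphism $P\to A$ with $P$ projective (an epimorphism $f:P\to A$ is essential if any $g:X\to P$ with $f\circ g$ epi is itself epi); it is unique up to isomorphism. SPCTs. A composition $\alpha=(\alpha_1,\dots,\alpha_k)\models n$ is a list of positive integers with sum $n$; $\ell(\alpha)=k$. $\mathrm{cd}(\alpha)$ is the left-justified array whose $i$th row from the top has $\alpha_i$ boxes; $(i,j)$ is the box in row $i$ (from the top) and column $j$ (from the left). $\alpha$ is compatible with $\sigma\in\mathfrak{S}_{\ell(\alpha)}$ if $\alpha_i\ge\alpha_j$ whenever $i<j$ and $\sigma(i)>\sigma(j)$. A standard permuted composition tableau (SPCT) of shape $\alpha$ and type $\sigma$ is a filling $\tau$ of $\mathrm{cd}(\alpha)$ with entries in $\{1,\dots,n\}$ such that: (1) entries are distinct;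 (2) the standardization of the first column read top to bottom is $\sigma$; (3) rows decrease left to right; (4) if $i<j$ and $\tau_{i,k}>\tau_{j,k+1}$, then $(i,k+1)\in\mathrm{cd}(\alpha)$ and $\tau_{i,k+1}>\tau_{j,k+1}$. $1\le i\le n-1$ is a descent of $\tau$ if $i+1$ lies weakly right of $i$; $\mathrm{Des}(\tau)$ is the set of descents. For $i<j$, $i$ and $j$ are attacking in $\tau$ if they are in the same column, or in adjacent columns with $j$ positioned lower-right of $i$. $\mathbf{S}^\sigma_\alpha$ is the $\mathbb{C}$-span of $\mathrm{SPCT}^\sigma(\alpha)$ (the set of these) with action: $\pi_i\cdot\tau=\tau$ if $i$ is not a descent; $0$ if $i$ is a descent and $i,i+1$ are attacking; $s_i\cdot\tau$ if $i$ is a descent and $i,i+1$ are nonattacking. Two SPCTs in $\mathrm{SPCT}^\sigma(\alpha)$ are equivalent if, for every column, the standardizations of their column words (read top to bottom) coincide; $\mathcal{E}^\sigma(\alpha)$ is the set of equivalence classes, and for $E\in\mathcal{E}^\sigma(\alpha)$, $\mathbf{S}^\sigma_{\alpha,E}$ is the submodule spanned by $E$. Each $E$ contains a unique source tableau $\tau_E$, i.e. one such that for every $i\notin\mathrm{Des}(\tau_E)$, $i\ne n$, the entry $i+1$ lies immediately left of $i$. Generalized ribbons. A generalized composition $\boldsymbol{\alpha}=\alpha^{(1)}\oplus\cdots\oplus\alpha^{(k)}$ of $n$ is a formal sum of nonempty compositions with total size $n$. The ribbon diagram $\mathrm{rd}(\beta)$ of a composition is the connected skew diagram without $2\times2$ squares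 whose $i$th row from the bottom has $\beta_i$ boxes; $\mathrm{rd}(\boldsymbol{\alpha})$ is the skew diagram with connected components $\mathrm{rd}(\alpha^{(1)}),\dots,\mathrm{rd}(\alpha^{(k)})$, where $\mathrm{rd}(\alpha^{(i+1)})$ is strictly northeast of $\mathrm{rd}(\alpha^{(i)})$. $\mathrm{SRT}(\boldsymbol{\alpha})$ is the set of fillings of $\mathrm{rd}(\boldsymbol{\alpha})$ by $1,\dots,n$ without repetition, rows increasing left to right and columns increasing top to bottom. $\overline{\mathbf{P}}_{\boldsymbol{\alpha}}$ is the $\mathbb{C}$-span of $\mathrm{SRT}(\boldsymbol{\alpha})$ with action: $\pi_i\star T=T$ if $i$ is strictly above $i+1$ in $T$; $0$ if $i,i+1$ are in the same row; $s_i\cdot T$ if $i$ is strictly below $i+1$. The generalized composition $\boldsymbol{\alpha}_E$. Write $\mathrm{Des}(\tau_E)=\{d_1<\cdots<d_m\}$, $d_0=0$, $d_{m+1}=n$. Near concatenation is $(\beta_1,\dots,\beta_k)\odot(\gamma_1,\dots,\gamma_l)=(\beta_1,\dots,\beta_{k-1},\beta_k+\gamma_1,\gamma_2,\dots,\gamma_l)$; for a generalized composition on the left, $\odot$ is applied to its last summand. Put $\boldsymbol{\alpha}^{(1)}=(1^{d_1})$ and, for $1\le j\le m$, $\boldsymbol{\alpha}^{(j+1)}=\boldsymbol{\alpha}^{(j)}\odot(1^{d_{j+1}-d_j})$ if in $\tau_E$ either $d_{j-1}+1$ is weakly right of $d_{j+1}$ or $d_{j-1}+1$ and $d_{j+1}$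 are attacking, and $\boldsymbol{\alpha}^{(j+1)}=\boldsymbol{\alpha}^{(j)}\oplus(1^{d_{j+1}-d_j})$ otherwise. Set $\boldsymbol{\alpha}_E=\boldsymbol{\alpha}^{(m+1)}$. *)

(* Defs.v *)
From HB Require Import structures.
From mathcomp Require Import all_boot all_order all_algebra perm.
From mathcomp Require Import boolp generic_quotient.
From mathcomp Require Import zify.

Set Implicit Arguments.
Unset Strict Implicit.
Unset Printing Implicit Defensive.

Import GRing.Theory.

(* The algebra H_n(0), as terms modulo the congruence generated by the       *)
(* axioms of K-algebras and the defining relations.                          *)

Section Hecke.
Variables (K : fieldType) (n : nat).
Local Open Scope ring_scope.

(* HGen i, for i : 'I_n.-1, is the generator pi_{i+1}. *)
Inductive hterm : Type :=
  | HGen of 'I_n.-1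
  | HScal of K
  | HAdd of hterm & hterm
  | HMul of hterm & hterm.

Inductive heq : hterm -> hterm -> Prop :=
  | heq_refl s : heq s s
  | heq_sym s t : heq s t -> heq t s
  | heq_trans s t u : heq s t -> heq t u -> heq s u
  | heq_add s s' t t' : heq s s' -> heq t t' -> heq (HAdd s t) (HAdd s' t')
  | heq_mul s s' t t' : heq s s' -> heq t t' -> heq (HMul s t) (HMul s' t')
  | heq_addA s t u : heq (HAdd s (HAdd t u)) (HAdd (HAdd s t) u)
  | heq_addC s t : heq (HAdd s t) (HAdd t s)
  | heq_add0 s : heq (HAdd (HScal 0) s) s
  | heq_addN s : heq (HAdd (HMul (HScal (-1)) s) s) (HScal 0)
  | heq_mulA s t u : heq (HMul s (HMul t u)) (HMul (HMul s t) u)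
  | heq_mul1l s : heq (HMul (HScal 1) s) s
  | heq_mul1r s : heq (HMul s (HScal 1)) s
  | heq_mulDl s t u : heq (HMul (HAdd s t) u) (HAdd (HMul s u) (HMul t u))
  | heq_mulDr s t u : heq (HMul s (HAdd t u)) (HAdd (HMul s t) (HMul s u))
  | heq_scalD a b : heq (HScal (a + b)) (HAdd (HScal a) (HScal b))
  | heq_scalM a b : heq (HScal (a * b)) (HMul (HScal a) (HScal b))
  | heq_scalC a s : heq (HMul (HScal a) s) (HMul s (HScal a))
  | heq_idem (i : 'I_n.-1) : heq (HMul (HGen i) (HGen i)) (HGen i)
  | heq_braid (i j : 'I_n.-1) : j = i.+1 :> nat ->
      heq (HMul (HGen i) (HMul (HGen j) (HGen i)))
          (HMul (HGen j) (HMul (HGen i) (HGen j)))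
  | heq_comm (i j : 'I_n.-1) : (i.+1 < j)%N ->
      heq (HMul (HGen i) (HGen j)) (HMul (HGen j) (HGen i)).

HB.instance Definition _ := gen_eqMixin hterm.
HB.instance Definition _ := gen_choiceMixin hterm.

Definition heqb : rel hterm := fun s t => `[< heq s t >].

Fact heqb_equiv : equiv_class_of heqb.
Proof.
split.
- by move=> s; apply/asboolP/heq_refl.
- by move=> s t; apply/asboolP/asboolP; apply: heq_sym.
- by move=> t s u /asboolP st /asboolP tu; apply/asboolP/(heq_trans st tu).
Qed.

Canonical heq_equiv := EquivRelPack heqb_equiv.

Definition hecke : Type := {eq_quot heq_equiv}%qT.
HB.instance Definition _ := Choice.on hecke.
HB.instance Definition _ := EqQuotient.on hecke.

Definition hcls (t : hterm) : hecke := (\pi_hecke t)%qT.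

Lemma hclsP s t : heq s t <-> hcls s = hcls t.
Proof.
split; first by move=> st; apply/eqmodP/asboolP.
by move/eqmodP/asboolP.
Qed.

Lemma hcls_repr (x : hecke) : hcls (repr x) = x.
Proof. exact: reprK. Qed.

Lemma repr_hcls t : heq (repr (hcls t)) t.
Proof. by apply/hclsP; rewrite hcls_repr. Qed.

Definition hadd (x y : hecke) : hecke := hcls (HAdd (repr x) (repr y)).
Definition hmul (x y : hecke) : hecke := hcls (HMul (repr x) (repr y)).
Definition hscal a (x : hecke) : hecke := hcls (HMul (HScal a) (repr x)).

Lemma haddE s t : hadd (hcls s) (hcls t) = hcls (HAdd s t).
Proof. by apply/hclsP/heq_add; apply: repr_hcls. Qed.

Lemma hmulE s t : hmul (hcls s) (hcls t) = hcls (HMul s t).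
Proof. by apply/hclsP/heq_mul; apply: repr_hcls. Qed.

Lemma hscalE a t : hscal a (hcls t) = hcls (HMul (HScal a) t).
Proof. by apply/hclsP/heq_mul; [apply: heq_refl | apply: repr_hcls]. Qed.

Lemma hcls_ind (P : hecke -> Prop) : (forall t, P (hcls t)) -> forall x, P x.
Proof. by move=> Pt x; rewrite -(hcls_repr x). Qed.

Fact haddA : associative hadd.
Proof.
elim/hcls_ind=> s; elim/hcls_ind=> t; elim/hcls_ind=> u.
by rewrite !haddE; apply/hclsP/heq_addA.
Qed.

Fact haddC : commutative hadd.
Proof.
elim/hcls_ind=> s; elim/hcls_ind=> t.
by rewrite !haddE; apply/hclsP/heq_addC.
Qed.

Fact hadd0 : left_id (hcls (HScal 0)) hadd.
Proof. by elim/hcls_ind=> s; rewrite haddE; apply/hclsP/heq_add0. Qed.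

Fact haddN : left_inverse (hcls (HScal 0)) (hscal (-1)) hadd.
Proof.
by elim/hcls_ind=> s; rewrite hscalE haddE; apply/hclsP/heq_addN.
Qed.

HB.instance Definition _ := GRing.isZmodule.Build hecke haddA haddC hadd0 haddN.

Lemma hclsD s t : hcls s + hcls t = hcls (HAdd s t).
Proof. exact: haddE. Qed.

Fact hmulA : associative hmul.
Proof.
elim/hcls_ind=> s; elim/hcls_ind=> t; elim/hcls_ind=> u.
by rewrite !hmulE; apply/hclsP/heq_mulA.
Qed.

Fact hmul1l : left_id (hcls (HScal 1)) hmul.
Proof. by elim/hcls_ind=> s; rewrite hmulE; apply/hclsP/heq_mul1l. Qed.

Fact hmul1r : right_id (hcls (HScal 1)) hmul.
Proof. by elim/hcls_ind=> s; rewrite hmulE; apply/hclsP/heq_mul1r. Qed.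

Fact hmulDl : left_distributive hmul +%R.
Proof.
elim/hcls_ind=> s; elim/hcls_ind=> t; elim/hcls_ind=> u.
by rewrite hclsD !hmulE hclsD; apply/hclsP/heq_mulDl.
Qed.

Fact hmulDr : right_distributive hmul +%R.
Proof.
elim/hcls_ind=> s; elim/hcls_ind=> t; elim/hcls_ind=> u.
by rewrite hclsD !hmulE hclsD; apply/hclsP/heq_mulDr.
Qed.

(* The character sending every generator to 0 separates 0 from 1. *)
Fixpoint heval0 (t : hterm) : K :=
  match t with
  | HGen _ => 0
  | HScal a => a
  | HAdd s t => heval0 s + heval0 t
  | HMul s t => heval0 s * heval0 t
  end.

Lemma heval0_heq s t : heq s t -> heval0 s = heval0 t.
Proof.
elim=> //= *; rewrite ?mul0r ?mulr0 ?add0r ?mul1r ?mulr1 ?addrA ?mulrA //;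
  try congruence.
- exact: addrC.
- by rewrite mulN1r addNr.
- exact: mulrDl.
- exact: mulrDr.
- exact: mulrC.
Qed.

Fact hone_neq0 : hcls (HScal 1) != 0.
Proof.
apply/eqP=> /hclsP/heval0_heq /= /eqP; apply/negP; exact: oner_neq0.
Qed.

HB.instance Definition _ := GRing.Zmodule_isNzRing.Build hecke
  hmulA hmul1l hmul1r hmulDl hmulDr hone_neq0.

Lemma hclsM s t : hcls s * hcls t = hcls (HMul s t).
Proof. exact: hmulE. Qed.

Fact hscalA a b x : hscal a (hscal b x) = hscal (a * b) x.
Proof.
elim/hcls_ind: x => s; rewrite !hscalE; apply/hclsP.
apply: heq_trans (heq_mulA _ _ _) _.
by apply: heq_mul; [apply/heq_sym/heq_scalM | apply: heq_refl].
Qed.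

Fact hscal1 : left_id 1 hscal.
Proof. by elim/hcls_ind=> s; rewrite hscalE; apply/hclsP/heq_mul1l. Qed.

Fact hscalDr : right_distributive hscal +%R.
Proof.
move=> a; elim/hcls_ind=> s; elim/hcls_ind=> t.
by rewrite hclsD !hscalE hclsD; apply/hclsP/heq_mulDr.
Qed.

Fact hscalDl x : {morph hscal^~ x : a b / a + b}.
Proof.
elim/hcls_ind: x => s a b.
rewrite !hscalE hclsD; apply/hclsP.
apply: heq_trans (heq_mulDl _ _ _).
by apply: heq_mul; [apply: heq_scalD | apply: heq_refl].
Qed.

HB.instance Definition _ := GRing.Zmodule_isLmodule.Build K hecke
  hscalA hscal1 hscalDr hscalDl.

Lemma hclsZ a t : a *: hcls t = hcls (HMul (HScal a) t).
Proof. exact: hscalE. Qed.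

Fact hscalAl a (x y : hecke) : a *: (x * y) = a *: x * y.
Proof.
elim/hcls_ind: x => s; elim/hcls_ind: y => t.
rewrite !(hclsM, hclsZ).
by apply/hclsP/heq_mulA.
Qed.

HB.instance Definition _ := GRing.Lmodule_isLalgebra.Build K hecke hscalAl.

Fact hscalAr a (x y : hecke) : a *: (x * y) = x * (a *: y).
Proof.
elim/hcls_ind: x => s; elim/hcls_ind: y => t.
rewrite !(hclsM, hclsZ); apply/hclsP.
apply: heq_trans (heq_mulA _ _ _) _.
apply: heq_trans (heq_sym (heq_mulA _ _ _)).
by apply: heq_mul; [apply: heq_scalC | apply: heq_refl].
Qed.

HB.instance Definition _ := GRing.Lalgebra_isAlgebra.Build K hecke hscalAr.

Definition hgen (i : 'I_n.-1) : hecke := hcls (HGen i).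

End Hecke.

(* Left modules over H_n(0) spanned by a finite set with a 0-Hecke action    *)
(* x |-> pi_i . x in T u {0}; None stands for 0.                             *)

Record hecke_action (n : nat) (T : finType) := HeckeAction {
  hact :> 'I_n.-1 -> T -> option T;
  hact_idem : forall i x, obind (hact i) (hact i x) = hact i x;
  hact_braid : forall (i j : 'I_n.-1) x, j = i.+1 :> nat ->
    obind (hact i) (obind (hact j) (hact i x)) =
    obind (hact j) (obind (hact i) (hact j x));
  hact_comm : forall (i j : 'I_n.-1) x, i.+1 < j ->
    obind (hact i) (hact j x) = obind (hact j) (hact i x)
}.

Section LinearExtension.
Variables (K : fieldType) (T : finType).
Local Open Scope ring_scope.
Implicit Types (f g : T -> option T) (v : {ffun T -> K^o}).

Definition linext f v : {ffun T -> K^o} :=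
  [ffun y => \sum_(x | f x == Some y) v x].

Fact linext_linear f : linear (linext f).
Proof.
move=> a u v; apply/ffunP=> y; rewrite !ffunE scaler_sumr -big_split /=.
by apply: eq_bigr => x _; rewrite !ffunE.
Qed.

Lemma linext_comp f g v :
  linext f (linext g v) = linext (fun x => obind f (g x)) v.
Proof.
apply/ffunP=> z; rewrite !ffunE.
under eq_bigr do rewrite ffunE.
rewrite (exchange_big_dep (fun x => obind f (g x) == Some z)) /=; last first.
  by move=> y x /eqP fy /eqP ->; apply/eqP.
apply: eq_bigr => x; case: (g x) => [y|] //= fy.
rewrite (big_pred1 y) // => w /=; rewrite (inj_eq Some_inj) [y == w]eq_sym.
by case: (w =P y) => [->|]; rewrite ?fy ?andbF.
Qed.

Lemma eq_linext f g : f =1 g -> linext f =1 linext g.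
Proof.
move=> fg v; apply/ffunP=> y; rewrite !ffunE.
by apply: eq_bigl => x; rewrite fg.
Qed.

End LinearExtension.

Section SpanModule.
Variables (K : fieldType) (n : nat) (T : finType) (a : hecke_action n T).
Local Open Scope ring_scope.
Local Notation H := (hecke K n).

Definition hspan & hecke_action n T : Type := {ffun T -> K^o}.
Local Notation V := (hspan a).
HB.instance Definition _ := GRing.Zmodule.copy V {ffun T -> K^o}.

Fixpoint heval (t : hterm K n) (v : {ffun T -> K^o}) : {ffun T -> K^o} :=
  match t with
  | HGen i => linext (a i) v
  | HScal c => c *: v
  | HAdd s t => heval s v + heval t v
  | HMul s t => heval s (heval t v)
  end.

Fact heval_linear t : linear (heval t).
Proof.
elim: t => [i|c|s IHs t IHt|s IHs t IHt] c' u v /=.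
- exact: linext_linear.
- by rewrite scalerDr !scalerA mulrC.
- by rewrite IHs IHt scalerDr addrACA.
- by rewrite IHt IHs.
Qed.

Lemma hevalD t u v : heval t (u + v) = heval t u + heval t v.
Proof. by have := heval_linear t 1 u v; rewrite !scale1r. Qed.

Lemma heval0v t : heval t 0 = 0.
Proof. by apply: (addrI (heval t 0)); rewrite -hevalD !addr0. Qed.

Lemma hevalZ t c v : heval t (c *: v) = c *: heval t v.
Proof. by have := heval_linear t c v 0; rewrite heval0v !addr0. Qed.

Lemma heval_heq s t : heq s t -> heval s =1 heval t.
Proof.
elim=> /=.
- by [].
- by move=> {}s {}t _ IH v; rewrite IH.
- by move=> {}s {}t u _ IHs _ IHt v; rewrite IHs.
- by move=> {}s s' {}t t' _ IHs _ IHt v; rewrite IHs IHt.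
- by move=> {}s s' {}t t' _ IHs _ IHt v; rewrite IHs IHt.
- by move=> {}s {}t u v; rewrite addrA.
- by move=> {}s {}t v; rewrite addrC.
- by move=> {}s v; rewrite scale0r add0r.
- by move=> {}s v; rewrite scaleN1r addNr scale0r.
- by [].
- by move=> {}s v; rewrite scale1r.
- by move=> {}s v; rewrite scale1r.
- by [].
- by move=> {}s {}t u v; rewrite hevalD.
- by move=> c d v; rewrite scalerDl.
- by move=> c d v; rewrite scalerA.
- by move=> c {}s v; rewrite hevalZ.
- by move=> i v; rewrite linext_comp; apply/eq_linext => x; rewrite hact_idem.
- move=> i j ij v; rewrite !linext_comp; apply/eq_linext => x.
  by move: (hact_braid a x ij); case: (a i x) => [?|]; case: (a j x).
- move=> i j ij v; rewrite !linext_comp; apply/eq_linext => x.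
  exact: hact_comm.
Qed.

Definition hsmul (h : H) (v : V) : V := heval (repr h) v.

Lemma hsmulE t v : hsmul (hcls t) v = heval t v.
Proof. exact/heval_heq/repr_hcls. Qed.

Fact hsmulA g h v : hsmul g (hsmul h v) = hsmul (g * h) v.
Proof.
elim/hcls_ind: g => s; elim/hcls_ind: h => t.
by rewrite hclsM !hsmulE.
Qed.

Fact hsmul1 : left_id 1 hsmul.
Proof. by move=> v; rewrite hsmulE /= scale1r. Qed.

Fact hsmulDr : right_distributive hsmul +%R.
Proof. by elim/hcls_ind=> s u v; rewrite !hsmulE hevalD. Qed.

Fact hsmulDl v : {morph hsmul^~ v : g h / g + h}.
Proof.
elim/hcls_ind=> s; elim/hcls_ind=> t.
by rewrite hclsD !hsmulE.
Qed.

HB.instance Definition _ := GRing.Zmodule_isLmodule.Build H V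
  hsmulA hsmul1 hsmulDr hsmulDl.

Definition hbasis (x : T) : V := [ffun y => (y == x)%:R].

Lemma hgenE i x :
  hgen K i *: hbasis x = if a i x is Some y then hbasis y else 0.
Proof.
rewrite [LHS]hsmulE /=; apply/ffunP=> y; rewrite ffunE.
rewrite (bigID (pred1 x)) /= [X in _ + X]big1 ?addr0; last first.
  by move=> z /andP[_ /negPf zx]; rewrite ffunE zx.
rewrite big_mkcond (bigD1 x) //= big1 => [|z /negPf ->]; last by rewrite andbF.
rewrite eqxx andbT addr0 ffunE eqxx; case: (a i x) => [z|] /=; last by rewrite ffunE.
by rewrite ffunE (inj_eq Some_inj) eq_sym; case: eqP.
Qed.

Lemma hscalarE c (v : V) x : ((c%:A : H) *: v) x = c * v x.
Proof. by rewrite hclsZ [_ *: v]hsmulE /= ffunE scale1r. Qed.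

End SpanModule.

(* Fillings of a finite diagram D by 1, ..., n. A box is a pair              *)
(* (row, column); rows and columns are numbered from 0.                      *)

Notation box := (nat * nat)%type.

Section Fillings.
Variables (D : seq box) (n : nat).

Definition filling := {ffun seq_sub D -> 'I_n.+1}.
Implicit Types (f : filling) (b : seq_sub D).

(* Each of 1, ..., n occurs exactly once. *)
Definition standard f : bool :=
  perm_eq [seq (f b : nat) | b : seq_sub D] (iota 1 n).

Definition box_of f (k : nat) : box :=
  if [pick b | f b == k :> nat] is Some b then ssval b else (0, 0).

Definition entry f (x : box) : nat :=
  if insub x is Some b then f b : nat else 0.

Definition swap (k : nat) f : filling :=
  [ffun b => tperm (inord k) (inord k.+1) (f b)].

Lemma standard_inj f b c : standard f -> f b = f c :> nat -> b = c.
Proof.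
move=> /perm_uniq; rewrite iota_uniq => /injectiveP; exact.
Qed.

Lemma standard_onto f k : standard f -> 0 < k <= n -> exists b, f b = k :> nat.
Proof.
move=> /perm_mem/(_ k); rewrite mem_iota add1n ltnS => + kn; rewrite kn.
by case/imageP=> b _ ->; exists b.
Qed.

Lemma standard_gt0 f b : standard f -> 0 < f b.
Proof.
move=> /perm_mem/(_ (f b)); rewrite (codom_f (fun c => f c : nat)) mem_iota.
by move=> /esym/andP[].
Qed.

Lemma box_ofE f b k : standard f -> f b = k :> nat -> box_of f k = ssval b.
Proof.
move=> sf fb; rewrite /box_of; case: pickP => [c /eqP fc|/(_ b)].
  by congr ssval; apply: (standard_inj sf); rewrite fc.
by rewrite fb eqxx.
Qed.

Lemma entryE f b : entry f (ssval b) = f b.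
Proof. by rewrite /entry valK. Qed.

Definition nswap k x := if x == k then k.+1 else if x == k.+1 then k else x.

Lemma nswapK k : involutive (nswap k).
Proof.
move=> x; rewrite /nswap; case: (eqVneq x k) => [->|xk].
  by rewrite eqxx (gtn_eqF (ltnSn k)).
case: (eqVneq x k.+1) => [->|xk1]; first by rewrite eqxx.
by rewrite (negPf xk) (negPf xk1).
Qed.

Lemma swapE k f b : k < n -> swap k f b = nswap k (f b) :> nat.
Proof.
move=> kn; have Ek : (inord k : 'I_n.+1) = k :> nat by rewrite inordK // ltnW.
have Ek1 : (inord k.+1 : 'I_n.+1) = k.+1 :> nat by rewrite inordK.
rewrite ffunE /nswap; case: tpermP => [->|->|].
- by rewrite Ek Ek1 eqxx.
- by rewrite Ek Ek1 (gtn_eqF (ltnSn k)) eqxx.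
- move=> /eqP; rewrite -val_eqE /= Ek => /negPf ->.
  by move=> /eqP; rewrite -val_eqE /= Ek1 => /negPf ->.
Qed.

Lemma standard_swap k f : 0 < k < n -> standard f -> standard (swap k f).
Proof.
move=> /andP[k0 kn] sf; rewrite /standard.
have -> : [seq (swap k f b : nat) | b : seq_sub D] =
          map (nswap k) [seq (f b : nat) | b : seq_sub D].
  by rewrite -map_comp; apply: eq_map => b /=; apply: swapE.
apply: perm_trans (perm_map _ sf) _; apply: uniq_perm.
- by rewrite map_inj_uniq ?iota_uniq //; apply/inv_inj/nswapK.
- exact: iota_uniq.
have sub x : 0 < x <= n -> 0 < nswap k x <= n.
  by rewrite /nswap; do 2?case: eqP => // _; rewrite ?k0 ?kn // (ltnW kn).
move=> x; rewrite -[in LHS](nswapK k x) mem_map; last exact/inv_inj/nswapK.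
rewrite !mem_iota !add1n !ltnS; apply/idP/idP => /sub //.
by rewrite nswapK.
Qed.

Lemma box_of_swap k f j : 0 < k < n -> standard f -> 0 < j <= n ->
  box_of (swap k f) j = box_of f (nswap k j).
Proof.
move=> kn sf jn; have [b fb] := standard_onto (standard_swap kn sf) jn.
rewrite (box_ofE (standard_swap kn sf) fb) (box_ofE (b := b)) //.
by case/andP: kn => _ kn; rewrite -fb swapE // nswapK.
Qed.

Lemma nswapC k l x : k.+1 < l -> nswap k (nswap l x) = nswap l (nswap k x).
Proof. by move=> kl; rewrite /nswap; do !case: eqP => //; lia. Qed.

Lemma nswap_braid k x :
  nswap k (nswap k.+1 (nswap k x)) = nswap k.+1 (nswap k (nswap k.+1 x)).
Proof. by rewrite /nswap; do !case: eqP => //; lia. Qed.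

Lemma swapC k l f : k.+1 < l -> l < n -> swap k (swap l f) = swap l (swap k f).
Proof.
move=> kl ln; have kn: k < n by apply: ltn_trans (ltnW kl) ln.
by apply/ffunP=> b; apply: ord_inj; rewrite !swapE // nswapC.
Qed.

Lemma swap_braid k f : k.+1 < n ->
  swap k (swap k.+1 (swap k f)) = swap k.+1 (swap k (swap k.+1 f)).
Proof.
move=> k1n; have kn := ltnW k1n.
by apply/ffunP=> b; apply: ord_inj; rewrite !swapE // nswap_braid.
Qed.

End Fillings.

(* Both tableau actions below are of this form: pi_k fixes f, kills f or     *)
(* swaps k and k+1, according to the boxes of k and k+1; fill_braid derives  *)
(* the 0-Hecke relations for both of them.                                   *)
Section FillingAction.
Variables (D : seq box) (n : nat) (P : pred (filling D n)).
Variables (fix_ kill : rel box).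

Let T := {f : filling D n | P f}.

Definition fill_act (i : 'I_n.-1) (t : T) : option T :=
  let x := box_of (val t) i.+1 in let y := box_of (val t) i.+2 in
  if fix_ x y then Some t else if kill x y then None
  else Some (insubd t (swap i.+1 (val t))).

Hypothesis P_standard : forall f, P f -> standard f.
Hypothesis P_swap : forall k f, 0 < k < n -> P f ->
  ~~ fix_ (box_of f k) (box_of f k.+1) -> ~~ kill (box_of f k) (box_of f k.+1) ->
  P (swap k f).
Variable h : box -> nat.
Hypothesis fixE : forall x y, fix_ x y = (h y < h x).
Hypothesis kill_eq : forall x y, h x = h y -> kill x y.

Let i_bd (i : 'I_n.-1) : 0 < i.+1 < n.
Proof. by rewrite /= -ltn_predRL. Qed.

Let i_bd1 (i : 'I_n.-1) : 0 < i.+1 <= n.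
Proof. exact: ltnW (i_bd i). Qed.

Let i_bd2 (i : 'I_n.-1) : 0 < i.+2 <= n.
Proof. exact: i_bd i. Qed.

Inductive fill_spec (i : 'I_n.-1) (t : T) : option T -> Prop :=
  | FillFix of h (box_of (val t) i.+2) < h (box_of (val t) i.+1) :
      fill_spec i t (Some t)
  | FillKill of h (box_of (val t) i.+1) <= h (box_of (val t) i.+2)
      & kill (box_of (val t) i.+1) (box_of (val t) i.+2) : fill_spec i t None
  | FillSwap u of h (box_of (val t) i.+1) < h (box_of (val t) i.+2)
      & ~~ kill (box_of (val t) i.+1) (box_of (val t) i.+2)
      & val u = swap i.+1 (val t) : fill_spec i t (Some u).

Lemma fill_actP i t : fill_spec i t (fill_act i t).
Proof.
rewrite /fill_act fixE; case: ltnP => [|le]; first exact: FillFix.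
case: ifPn => [|nk]; first exact: FillKill.
apply: FillSwap => //.
  rewrite ltn_neqAle le andbT; apply: contra nk => /eqP; exact: kill_eq.
rewrite val_insubd P_swap ?i_bd ?(valP t) //.
by rewrite fixE -leqNgt.
Qed.

Lemma fill_fix (i : 'I_n.-1) (t : T) : h (box_of (val t) i.+2) < h (box_of (val t) i.+1) ->
  fill_act i t = Some t.
Proof. by case: fill_actP => // [+ _|u + _ _]; lia. Qed.

Lemma fill_kill (i : 'I_n.-1) (t : T) : h (box_of (val t) i.+1) <= h (box_of (val t) i.+2) ->
  kill (box_of (val t) i.+1) (box_of (val t) i.+2) -> fill_act i t = None.
Proof. by case: fill_actP => // [|u _ /negPf ->] //; lia. Qed.

Lemma box_swapl (i : 'I_n.-1) (t u : T) : val u = swap i.+1 (val t) ->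
  box_of (val u) i.+1 = box_of (val t) i.+2.
Proof.
move=> ->; rewrite box_of_swap ?i_bd ?i_bd1 ?P_standard ?(valP t) //.
by rewrite /nswap eqxx.
Qed.

Lemma box_swapr (i : 'I_n.-1) (t u : T) : val u = swap i.+1 (val t) ->
  box_of (val u) i.+2 = box_of (val t) i.+1.
Proof.
move=> ->; rewrite box_of_swap ?i_bd ?i_bd2 ?P_standard ?(valP t) //.
by rewrite /nswap (gtn_eqF (ltnSn _)) eqxx.
Qed.

Lemma box_swapn (i : 'I_n.-1) k (t u : T) : val u = swap i.+1 (val t) ->
  0 < k <= n -> k != i.+1 -> k != i.+2 -> box_of (val u) k = box_of (val t) k.
Proof.
move=> -> kn ki ki2; rewrite box_of_swap ?i_bd ?P_standard ?(valP t) //.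
by rewrite /nswap (negPf ki) (negPf ki2).
Qed.

Lemma fill_idem i t : obind (fill_act i) (fill_act i t) = fill_act i t.
Proof.
case: fill_actP => //= [/fill_fix //|u lt _ tu].
by rewrite fill_fix // (box_swapl tu) (box_swapr tu).
Qed.

Lemma fill_comm (i j : 'I_n.-1) t : i.+1 < j ->
  obind (fill_act i) (fill_act j t) = obind (fill_act j) (fill_act i t).
Proof.
move=> ij.
have Bj (u v : T) : val v = swap i.+1 (val u) ->
    (box_of (val v) j.+1 = box_of (val u) j.+1) *
    (box_of (val v) j.+2 = box_of (val u) j.+2).
  by move=> uv; rewrite !(box_swapn uv) ?i_bd1 ?i_bd2 //; lia.
have Bi (u v : T) : val v = swap j.+1 (val u) ->
    (box_of (val v) i.+1 = box_of (val u) i.+1) *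
    (box_of (val v) i.+2 = box_of (val u) i.+2).
  by move=> uv; rewrite !(box_swapn uv) ?i_bd1 ?i_bd2 //; lia.
case: (fill_actP j t) => [jt|jt kj|u jt nkj tu];
  case: (fill_actP i t) => [it|it ki|v it nki tv] //=.
- by rewrite fill_fix // fill_fix.
- by case: fill_actP => // [|w _]; [lia | rewrite ki].
- rewrite (fill_fix (i := j)) ?(Bj _ _ tv) //.
  case: fill_actP => // [|_|w _ _ tw]; [lia | by rewrite (negPf nki) |].
  by congr Some; apply: val_inj; rewrite tv.
- by rewrite fill_kill.
- by rewrite fill_kill ?(Bj _ _ tv).
- rewrite fill_fix ?(Bi _ _ tu) //.
  case: fill_actP => // [|_|w _ _ tw]; [lia | by rewrite (negPf nkj) |].
  by congr Some; apply: val_inj; rewrite tu.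
- by rewrite fill_kill ?(Bi _ _ tu).
- case: (fill_actP i u); rewrite !(Bi _ _ tu);
    [lia | by rewrite (negPf nki) | move=> w _ _ uw].
  case: (fill_actP j v); rewrite !(Bj _ _ tv);
    [lia | by rewrite (negPf nkj) | move=> w' _ _ vw'].
  congr Some; apply: val_inj; rewrite uw vw' tu tv swapC //.
  by case/andP: (i_bd j).
Qed.

Lemma fill_swap (i : 'I_n.-1) (t : T) :
  h (box_of (val t) i.+1) <= h (box_of (val t) i.+2) ->
  ~~ kill (box_of (val t) i.+1) (box_of (val t) i.+2) ->
  exists2 u, fill_act i t = Some u & val u = swap i.+1 (val t).
Proof. by case: fill_actP => [| _ -> //|u _ _ tu _ _]; [lia | exists u]. Qed.

Lemma fill_braid (i j : 'I_n.-1) t : j = i.+1 :> nat ->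
  obind (fill_act i) (obind (fill_act j) (fill_act i t)) =
  obind (fill_act j) (obind (fill_act i) (fill_act j t)).
Proof.
move=> ij.
pose X (u : T) := box_of (val u) i.+1.
pose Y (u : T) := box_of (val u) i.+2.
pose Z (u : T) := box_of (val u) i.+3.
have fI u : h (Y u) < h (X u) -> fill_act i u = Some u by exact: fill_fix.
have fJ u : h (Z u) < h (Y u) -> fill_act j u = Some u.
  by move=> lt; apply: fill_fix; rewrite ij.
have kI u : h (X u) <= h (Y u) -> kill (X u) (Y u) -> fill_act i u = None.
  exact: fill_kill.
have kJ u : h (Y u) <= h (Z u) -> kill (Y u) (Z u) -> fill_act j u = None.
  by move=> le k; apply: fill_kill; rewrite ij.
have sI u : h (X u) <= h (Y u) -> ~~ kill (X u) (Y u) ->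
    exists v, [/\ fill_act i u = Some v, val v = swap i.+1 (val u),
                 X v = Y u, Y v = X u & Z v = Z u].
  move=> le nk; have [v Ev uv] := fill_swap le nk; exists v; split=> //.
  - exact: box_swapl uv.
  - exact: box_swapr uv.
  - by apply: (box_swapn uv); [have := i_bd2 j; rewrite ij | lia | lia].
have sJ u : h (Y u) <= h (Z u) -> ~~ kill (Y u) (Z u) ->
    exists v, [/\ fill_act j u = Some v, val v = swap i.+2 (val u),
                 X v = X u, Y v = Z u & Z v = Y u].
  move=> le nk; have [| |v Ev uv] := @fill_swap j u; rewrite ?ij //.
  exists v; split=> //; first by rewrite uv ij.
  - by apply: (box_swapn uv); [apply: i_bd1 | rewrite ij; lia | rewrite ij; lia].
  - by have := box_swapl uv; rewrite ij.
  - by have := box_swapr uv; rewrite ij.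
have st x y : h x <= h y -> ~~ kill x y -> h x < h y.
  move=> le nk; rewrite ltn_neqAle le andbT.
  by apply: contra nk => /eqP; apply: kill_eq.
have [hxy|hxy] := ltnP (h (Y t)) (h (X t)).
  rewrite (fI t) //=; have [hyz|hyz] := ltnP (h (Z t)) (h (Y t)).
    by rewrite (fJ t) //= (fI t) //= (fJ t).
  have [kyz|nkyz] := boolP (kill (Y t) (Z t)); first by rewrite (kJ t).
  have [//|//|v [-> _ Xv Yv Zv] /=] := sJ t.
  have [hxz|hxz] := ltnP (h (Z t)) (h (X t)).
    by rewrite (fI v) ?Xv ?Yv //= fJ // Yv Zv st.
  have [kxz|nkxz] := boolP (kill (X t) (Z t)); first by rewrite (kI v) ?Xv ?Yv.
  have [||w [-> _ Xw Yw Zw] /=] := sI v; rewrite ?Xv ?Yv //.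
  by rewrite fJ // Yw Zw Xv Zv.
have [kxy|nkxy] := boolP (kill (X t) (Y t)).
  rewrite (kI t) //=; have [hyz|hyz] := ltnP (h (Z t)) (h (Y t)).
    by rewrite (fJ t) //= (kI t).
  have [kyz|nkyz] := boolP (kill (Y t) (Z t)); first by rewrite (kJ t).
  have [//|//|v [-> _ Xv Yv Zv] /=] := sJ t.
  have [kxz|nkxz] := boolP (kill (X t) (Z t)).
    by rewrite (kI v) ?Xv ?Yv //; lia.
  have [||w [-> _ Xw Yw Zw] /=] := sI v; rewrite ?Xv ?Yv //; first by lia.
  by rewrite kJ // Yw Zw Xv Zv.
have [//|//|u [-> tu Xu Yu Zu] /=] := sI t.
have [hyz|hyz] := ltnP (h (Z t)) (h (Y t)).
  rewrite (fJ t) //=; have [//|//|u' [Eu' tu' _ _ _]] := sI t.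
  have -> : fill_act i t = Some u by rewrite Eu'; congr Some; apply/val_inj; rewrite tu'.
  rewrite /=; have [hxz|hxz] := ltnP (h (Z t)) (h (X t)).
    by rewrite (fJ u) ?Yu ?Zu //= fI // Xu Yu st.
  have [kxz|nkxz] := boolP (kill (X t) (Z t)); first by rewrite (kJ u) ?Yu ?Zu.
  have [||w [-> _ Xw Yw Zw] /=] := sJ u; rewrite ?Yu ?Zu //.
  by rewrite fI // Xw Yw Xu Zu.
have [kyz|nkyz] := boolP (kill (Y t) (Z t)).
  rewrite (kJ t) //=; have [kxz|nkxz] := boolP (kill (X t) (Z t)).
    by rewrite (kJ u) ?Yu ?Zu //; lia.
  have [||w [-> _ Xw Yw Zw] /=] := sJ u; rewrite ?Yu ?Zu //; first by lia.
  by rewrite kI // Xw Yw Xu Zu.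
have [//|//|v [-> tv Xv Yv Zv] /=] := sJ t.
have [kxz|nkxz] := boolP (kill (X t) (Z t)).
  by rewrite (kJ u) ?Yu ?Zu ?(kI v) ?Xv ?Yv //; lia.
have [||w [-> uw Xw Yw Zw] /=] := sJ u; rewrite ?Yu ?Zu //; first by lia.
have [||w' [-> vw' Xw' Yw' Zw'] /=] := sI v; rewrite ?Xv ?Yv //; first by lia.
have [||r [-> wr _ _ _]] := sI w; rewrite ?Xw ?Yw ?Xu ?Zu //.
have [||r' [-> wr' _ _ _]] := sJ w'; rewrite ?Yw' ?Zw' ?Xv ?Zv //.
congr Some; apply: val_inj; rewrite wr uw tu wr' vw' tv swap_braid //.
by have /andP[_] := i_bd j; rewrite ij.
Qed.

Definition fill_hecke : hecke_action n T :=
  HeckeAction fill_idem fill_braid fill_comm.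

End FillingAction.

Definition is_comp (n : nat) (alpha : seq nat) : bool :=
  (0 \notin alpha) && (sumn alpha == n).

Definition compatible (alpha : seq nat) (sigma : 'S_(size alpha)) : Prop :=
  forall i j : 'I_(size alpha), i < j -> sigma j < sigma i ->
    nth 0 alpha j <= nth 0 alpha i.

Definition cd (alpha : seq nat) : seq box :=
  [seq (i, j) | i <- iota 0 (size alpha), j <- iota 0 (nth 0 alpha i)].

(* Standardization of a word with distinct letters, with values from 0. *)
Definition std (w : seq nat) : seq nat :=
  [seq count (fun y => y < x) w | x <- w].

Definition weakly_right (x y : box) : bool := y.2 <= x.2.

(* x and y are the boxes of entries i < j, in this order; rows of cd(alpha)  *)
(* are numbered from the top, so a larger row is lower.                      *)
Definition attacking (x y : box) : bool :=
  (x.2 == y.2) || ((y.2 == x.2.+1) && (x.1 < y.1)).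

Section SPCT.
Variables (n : nat) (alpha : seq nat) (sigma : 'S_(size alpha)).
Implicit Types (f : filling (cd alpha) n).

Definition col_word f (c : nat) : seq nat :=
  [seq entry f (r, c) | r <- iota 0 (size alpha) & (r, c) \in cd alpha].

Definition rows_decrease f : bool :=
  [forall b, forall c, ((ssval b).1 == (ssval c).1) &&
    ((ssval b).2 < (ssval c).2) ==> (f c < f b)].

Definition triple_rule f : bool :=
  [forall b, forall c,
    [&& (ssval b).1 < (ssval c).1, (ssval c).2 == (ssval b).2.+1 & f c < f b] ==>
    [exists d, (ssval d == ((ssval b).1, (ssval c).2)) && (f c < f d)]].

Definition is_spct f : bool :=
  [&& standard f,
      std (col_word f 0) == [seq (sigma i : nat) | i <- enum 'I_(size alpha)],
      rows_decrease f
    & triple_rule f].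

Definition spct := {f : filling (cd alpha) n | is_spct f}.
Implicit Types t u : spct.

Definition descent t (i : nat) : bool :=
  weakly_right (box_of (val t) i.+1) (box_of (val t) i).

Definition Des t : seq nat := [seq i <- iota 1 n.-1 | descent t i].

(* The action of pi_{i+1}. The swapped filling is again an SPCT (lemma       *)
(* is_spct_swap), so the default value in insubd is never used.              *)
Definition spct_act (i : 'I_n.-1) t : option spct :=
  if ~~ descent t i.+1 then Some t
  else if attacking (box_of (val t) i.+1) (box_of (val t) i.+2) then None
  else Some (insubd t (swap i.+1 (val t))).

Definition spct_equiv t u : bool :=
  [forall c : 'I_n, std (col_word (val t) c) == std (col_word (val u) c)].

Definition is_source t : bool :=
  all (fun i => (i \notin Des t) ==>
         (box_of (val t) i == ((box_of (val t) i.+1).1, (box_of (val t) i.+1).2.+1)))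
      (iota 1 n.-1).

Lemma nswap_lt k x y : ~~ ((x == k) && (y == k.+1)) ->
  ~~ ((x == k.+1) && (y == k)) -> (nswap k x < nswap k y) = (x < y).
Proof. by rewrite /nswap; do 4!case: eqP => //; lia. Qed.

Lemma lt_swap k f (b c : seq_sub (cd alpha)) : 0 < k < n -> standard f ->
  (ssval b, ssval c) != (box_of f k, box_of f k.+1) ->
  (ssval c, ssval b) != (box_of f k, box_of f k.+1) ->
  (swap k f b < swap k f c) = (f b < f c).
Proof.
move=> /andP[_ kn] sf bc cb; rewrite !swapE // nswap_lt //.
  apply: contra bc => /andP[/eqP fb /eqP fc].
  by rewrite (box_ofE sf fb) (box_ofE sf fc).
apply: contra cb => /andP[/eqP fb /eqP fc].
by rewrite (box_ofE sf fb) (box_ofE sf fc).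
Qed.

Lemma col_word_swap k f c : k < n ->
  col_word (swap k f) c = map (nswap k) (col_word f c).
Proof.
move=> kn; rewrite /col_word -map_comp; apply/eq_in_map => r /=.
rewrite mem_filter => /andP[rc _].
by rewrite -[(r, c)]/(ssval (SeqSub rc)) !entryE swapE.
Qed.

Lemma mem_col_word f c k : standard f -> k \in col_word f c ->
  (box_of f k).2 = c.
Proof.
move=> sf /mapP[r]; rewrite mem_filter => /andP[rc _] ->.
by rewrite -[(r, c)]/(ssval (SeqSub rc)) entryE (box_ofE sf (erefl _)).
Qed.

Lemma std_swap k f c : 0 < k < n -> standard f ->
  (box_of f k).2 != (box_of f k.+1).2 ->
  std (col_word (swap k f) c) = std (col_word f c).
Proof.
move=> /andP[k0 kn] sf ne; rewrite col_word_swap // /std -map_comp.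
apply/eq_in_map => x xw /=; rewrite count_map; apply/eq_in_count => y yw /=.
apply: nswap_lt; apply: contra ne => /andP[/eqP ye /eqP xe]; subst.
  by rewrite !(mem_col_word sf xw, mem_col_word sf yw).
by rewrite !(mem_col_word sf xw, mem_col_word sf yw).
Qed.

Lemma is_spct_swap k f : 0 < k < n -> is_spct f ->
  ~~ ((box_of f k.+1).2 < (box_of f k).2) ->
  ~~ attacking (box_of f k) (box_of f k.+1) -> is_spct (swap k f).
Proof.
move=> kn /and4P[sf cf rf tf]; rewrite -leqNgt /attacking negb_or => le.
case/andP=> ne; rewrite negb_and => nadj; apply/and4P; split.
- exact: standard_swap.
- by rewrite std_swap.
- apply/forallP=> b; apply/forallP=> c; apply/implyP=> /andP[/eqP rbc cbc].
  move/forallP: (rf) => /(_ b)/forallP/(_ c).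
  rewrite rbc eqxx cbc /= => lt; rewrite lt_swap //.
    by apply/eqP => -[xc xb]; move: le; rewrite -xc -xb leqNgt cbc.
  apply/eqP => -[xb xc].
  have [b' fb'] := standard_onto sf (k := k) ltac:(lia).
  have [c' fc'] := standard_onto sf (k := k.+1) ltac:(lia).
  have eb : b = b' by apply: val_inj; rewrite /= xb (box_ofE sf fb').
  have ec : c = c' by apply: val_inj; rewrite /= xc (box_ofE sf fc').
  by move: lt; rewrite eb ec fb' fc'; lia.
- apply/forallP=> b; apply/forallP=> c; apply/implyP=> /and3P[rbc /eqP cbc].
  rewrite lt_swap //; first last.
  + by apply/eqP=> -[xb xc]; move: nadj; rewrite -xb -xc cbc eqxx rbc.
  + by apply/eqP=> -[xc xb]; move: le; rewrite -xc -xb cbc ltnn.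
  move=> lt; move/forallP: (tf) => /(_ b)/forallP/(_ c).
  rewrite rbc cbc eqxx lt => /existsP[d /andP[/eqP de dlt]].
  apply/existsP; exists d; rewrite de eqxx /= lt_swap //.
  + by apply/eqP=> -[xc xd]; move: ne; rewrite -xc -xd de /= cbc eqxx.
  + by apply/eqP=> -[xd xc]; move: ne; rewrite -xc -xd de /= cbc eqxx.
Qed.

Fact spct_standard f : is_spct f -> standard f.
Proof. by case/andP. Qed.

Fact attacking_eq (x y : box) : x.2 = y.2 -> attacking x y.
Proof. by rewrite /attacking => ->; rewrite eqxx. Qed.

Let spct_fix (x y : box) : bool := ~~ weakly_right y x.

Let spct_fixE x y : spct_fix x y = (y.2 < x.2).
Proof. by rewrite /spct_fix /weakly_right ltnNge. Qed.

Let spct_swapP k f : 0 < k < n -> is_spct f ->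
  ~~ spct_fix (box_of f k) (box_of f k.+1) ->
  ~~ attacking (box_of f k) (box_of f k.+1) -> is_spct (swap k f).
Proof. by move=> ? ?; rewrite spct_fixE; apply: is_spct_swap. Qed.

Definition spct_hecke : hecke_action n spct :=
  @HeckeAction n spct spct_act
    (fill_idem spct_standard spct_swapP spct_fixE attacking_eq)
    (fill_braid spct_standard spct_swapP spct_fixE attacking_eq)
    (fill_comm spct_standard spct_swapP spct_fixE attacking_eq).

Definition spct_class :=
  {E : {set spct} | E \in equivalence_partition spct_equiv [set: spct]}.
End SPCT.

Section SPCTModule.
Variables (K : fieldType) (n : nat) (alpha : seq nat).
Variables (sigma : 'S_(size alpha)) (E : spct_class n sigma).
Local Open Scope ring_scope.
Local Notation H := (hecke K n).

Definition spct_mod : lmodType H := hspan K (spct_hecke n sigma).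

Definition class_span : pred spct_mod :=
  fun v => [forall t, (t \notin val E) ==> (v t == 0)].

Lemma spct_equiv_act (i : 'I_n.-1) (t u : spct n sigma) :
  spct_act i t = Some u -> spct_equiv t u.
Proof.
rewrite /spct_act; case: ifPn => [_ [<-]|]; first exact/forallP.
rewrite negbK => desc; case: ifPn => // nat_ [<-]; apply/forallP=> c.
have i_bd : (0 < i.+1 < n)%N by rewrite /= -ltn_predRL.
rewrite val_insubd is_spct_swap ?(valP t) -?leqNgt // std_swap //.
  exact: spct_standard (valP t).
by apply: contra nat_ => /eqP; apply: attacking_eq.
Qed.

Lemma class_act (i : 'I_n.-1) (t u : spct n sigma) :
  spct_act i t = Some u -> (t \in val E) = (u \in val E).
Proof.
move=> /spct_equiv_act/forallP tu.
have /imsetP[x _ ->] := valP E; rewrite !inE /=.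
by apply/forallP/forallP=> xt c; have := xt c; rewrite (eqP (tu c)).
Qed.

Lemma class_span_heval (s : hterm K n) (v : spct_mod) :
  v \in class_span -> heval (spct_hecke n sigma) s v \in class_span.
Proof.
elim: s v => [i|c|s IHs s' IHs'|s IHs s' IHs'] v /= vE; last by apply/IHs/IHs'.
- apply/forallP=> u; apply/implyP=> uE; rewrite ffunE big1 // => t /eqP tu.
  apply/eqP/(implyP (forallP vE t)).
  by rewrite (class_act tu).
- apply/forallP=> u; apply/implyP=> uE; rewrite ffunE.
  by rewrite (eqP (implyP (forallP vE u) uE)) scaler0.
- apply/forallP=> u; apply/implyP=> uE; rewrite ffunE.
  rewrite (eqP (implyP (forallP (IHs v vE) u) uE)).
  by rewrite (eqP (implyP (forallP (IHs' v vE) u) uE)) addr0.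
Qed.

Fact class_span_closed : submod_closed class_span.
Proof.
split=> [|h u v uE vE].
  by apply/forallP=> t; apply/implyP=> _; rewrite ffunE.
apply/forallP=> t; apply/implyP=> tE; rewrite ffunE.
have huE : h *: u \in class_span by apply: class_span_heval.
rewrite (eqP (implyP (forallP huE t) tE)).
by rewrite (eqP (implyP (forallP vE t) tE)) addr0.
Qed.

HB.instance Definition _ :=
  GRing.isSubmodClosed.Build H spct_mod class_span class_span_closed.

Record spct_class_mod := SpctClassMod {
  class_val :> spct_mod;
  _ : class_val \in class_span
}.

HB.instance Definition _ := [isSub for class_val].
HB.instance Definition _ := [Choice of spct_class_mod by <:].
HB.instance Definition _ := [SubChoice_isSubLmodule of spct_class_mod by <:].

End SPCTModule.

(* Generalized ribbons. A generalized composition alpha^(1) (+) ... (+)      *)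
(* alpha^(k) is the list of its summands.                                    *)

(* The boxes of a ribbon whose lowest row is r and whose first column is c.  *)
(* Here rows are numbered from the bottom: a larger row is higher. The last  *)
(* box of a row is just below the first box of the next row.                 *)
Fixpoint rd_from (r c : nat) (beta : seq nat) : seq box :=
  if beta is b :: beta' then
    [seq (r, c + j) | j <- iota 0 b] ++ rd_from r.+1 (c + b.-1) beta'
  else [::].

(* The ribbon of beta has sumn beta - size beta + 1 columns; the next        *)
(* component starts one row higher and one column further right.             *)
Fixpoint grd_from (r c : nat) (A : seq (seq nat)) : seq box :=
  if A is beta :: A' then
    rd_from r c beta ++
    grd_from (r + size beta) (c + (sumn beta - size beta).+1) A'
  else [::].

Definition grd (A : seq (seq nat)) : seq box := grd_from 0 0 A.

Section SRT.
Variables (n : nat) (A : seq (seq nat)).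

Definition is_srt (f : filling (grd A) n) : bool :=
  [&& standard f,
      [forall b, forall c, ((ssval b).1 == (ssval c).1) &&
         ((ssval b).2 < (ssval c).2) ==> (f b < f c)]
    & [forall b, forall c, ((ssval b).2 == (ssval c).2) &&
         ((ssval c).1 < (ssval b).1) ==> (f b < f c)]].

Definition srt := {f : filling (grd A) n | is_srt f}.

Definition strictly_above (x y : box) : bool := y.1 < x.1.
Definition same_row (x y : box) : bool := x.1 == y.1.

(* The action of pi_{i+1}. The swapped filling is again in SRT (lemma        *)
(* is_srt_swap), so the default value in insubd is never used.               *)
Definition srt_act (i : 'I_n.-1) (t : srt) : option srt :=
  let x := box_of (val t) i.+1 in let y := box_of (val t) i.+2 in
  if strictly_above x y then Some t
  else if same_row x y then None
  else Some (insubd t (swap i.+1 (val t))).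

Lemma is_srt_swap k (f : filling (grd A) n) : 0 < k < n -> is_srt f ->
  ~~ strictly_above (box_of f k) (box_of f k.+1) ->
  ~~ same_row (box_of f k) (box_of f k.+1) -> is_srt (swap k f).
Proof.
move=> kn /and3P[sf rf cf]; rewrite /strictly_above -leqNgt => le ne.
have [_ kn'] := andP kn.
have lt_swap' (b c : seq_sub (grd A)) : f b < f c ->
    (ssval b, ssval c) != (box_of f k, box_of f k.+1) ->
    swap k f b < swap k f c.
  move=> lt bc; rewrite !swapE // nswap_lt //.
    apply: contra bc => /andP[/eqP fb /eqP fc].
    by rewrite (box_ofE sf fb) (box_ofE sf fc).
  by apply/negP=> /andP[/eqP fb /eqP fc]; move: lt; rewrite fb fc ltnNge leqnSn.
apply/and3P; split; first exact: standard_swap.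
- apply/forallP=> b; apply/forallP=> c; apply/implyP=> bc.
  apply: lt_swap'; first exact: (implyP (forallP (forallP rf b) c)).
  apply: contra ne => /eqP[<- <-]; by case/andP: bc.
- apply/forallP=> b; apply/forallP=> c; apply/implyP=> bc.
  apply: lt_swap'; first exact: (implyP (forallP (forallP cf b) c)).
  apply/eqP=> -[xb xc]; move: le; rewrite -xb -xc leqNgt.
  by case/andP: bc => _ ->.
Qed.

Fact srt_standard f : is_srt f -> standard f.
Proof. by case/andP. Qed.

Fact same_row_eq (x y : box) : x.1 = y.1 -> same_row x y.
Proof. by rewrite /same_row => ->. Qed.

Definition srt_hecke : hecke_action n srt :=
  @HeckeAction n srt srt_act
    (fill_idem srt_standard is_srt_swap (fun x y => erefl _) same_row_eq)
    (fill_braid srt_standard is_srt_swap (fun x y => erefl _) same_row_eq)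
    (fill_comm srt_standard is_srt_swap (fun x y => erefl _) same_row_eq).

Definition srt_mod (K : fieldType) : lmodType (hecke K n) := hspan K srt_hecke.

End SRT.

Definition near_concat (beta gamma : seq nat) : seq nat :=
  take (size beta).-1 beta ++ (last 0 beta + head 0 gamma) :: behead gamma.

Definition gnear_concat (A : seq (seq nat)) (gamma : seq nat) :=
  rcons (take (size A).-1 A) (near_concat (last [::] A) gamma).

Section AlphaE.
Variables (n : nat) (alpha : seq nat) (sigma : 'S_(size alpha)).

Section Source.
Variable t : spct n sigma.

(* d_0 = 0, the descents d_1 < ... < d_m, d_{m+1} = n. *)
Definition dseq (j : nat) : nat := nth n (0 :: Des t) j.

Definition merges (j : nat) : bool :=
  let x := box_of (val t) (dseq j.-1).+1 in
  let y := box_of (val t) (dseq j.+1) in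
  weakly_right x y || attacking x y.

(* alpha_upto j is alpha^(j+1). *)
Fixpoint alpha_upto (j : nat) : seq (seq nat) :=
  if j is j'.+1 then
    let gamma := nseq (dseq j.+1 - dseq j) 1 in
    if merges j then gnear_concat (alpha_upto j') gamma
    else rcons (alpha_upto j') gamma
  else [:: nseq (dseq 1) 1].

Definition alpha_source : seq (seq nat) := alpha_upto (size (Des t)).
End Source.

(* The pick returns the unique source tableau of E. *)
Definition alpha_class (E : spct_class n sigma) : seq (seq nat) :=
  if [pick t in val E | is_source t] is Some t then alpha_source t else [::].
End AlphaE.

Section ProjectiveCover.
Variable R : pzRingType.

Definition surj (A B : Type) (f : A -> B) : Prop := forall y, exists x, f x = y.

Definition projective (P : lmodType R) : Prop :=
  forall (M N : lmodType R) (g : {linear M -> N}) (f : {linear P -> N}),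
    surj g -> exists h : {linear P -> M}, forall x, g (h x) = f x.

Definition essential_epi (P A : lmodType R) (f : {linear P -> A}) : Prop :=
  surj f /\ forall (X : lmodType R) (g : {linear X -> P}), surj (f \o g) -> surj g.

Definition projective_cover (P A : lmodType R) : Prop :=
  projective P /\ exists f : {linear P -> A}, essential_epi f.

End ProjectiveCover.

(* Main.v *)
(* Reading a ribbon diagram from its bottom left to its top right end turns   *)
(* SRT(A) into the set of permutations with prescribed ascents (at I, the    *)
(* joints inside rows) and descents (at J, the joints inside columns); pi_i   *)
(* acts by the left 0-Hecke product with s_i, truncated to this set.         *)
(* Projectivity: T |-> pi_T eps, with eps = prod (1 - pi_k) over a word of    *)
(* w_0(I), embeds the ribbon module in H_n(0), and followed by evaluation at *)
(* the generator g = w_0(J) it is unitriangular for a length statistic.      *)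
(* Evaluation at g + r is still unitriangular when r is supported on words   *)
(* outside the parabolic subgroup omitting I; hence an epimorphism whose     *)
(* kernel is supported there is essential.                                   *)
(* On the tableau side, a class E is the set of linear extensions of a poset *)
(* that is read off its source tableau. Matching the source tableau with g   *)
(* identifies E with a set of ribbon words which contains those of that      *)
(* parabolic subgroup and whose complement is closed under the action, so    *)
(* killing the complement is the required epimorphism.                       *)

From HB Require Import structures.
Require Import Defs.
From mathcomp Require Import all_boot all_order all_algebra fingroup perm.
From mathcomp Require Import ssrAC reals complex zify.

Set Implicit Arguments.
Unset Strict Implicit.
Unset Printing Implicit Defensive.

Import GroupScope GRing.Theory.

(** * The weak orders of the symmetric group *)

(** A ribbon tableau is identified with the word of its entries, read from bottom left to top right.
    The basis becomes the set of words with ascents at the row joints I and descents at the column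
    joints J, and pi_i acts by left multiplication in the 0-Hecke monoid, a product that leaves the
    set being 0. Left and right multiplication commute ([rho_lam]), so descents at J persist and a
    product can leave only by gaining a descent at I. The longest element g of the parabolic
    subgroup of J generates the module ([F_gen]).

    Let eps be the product of the 1 - pi_k along a word of w_0(I). It is killed by pi_k on the left
    for k in I, so x -> pi_x eps is a homomorphism into H_n(0). Let y = g + r, where every word in
    the support of r involves some letter of I. Then pi_x eps y is x plus longer words: pi_x g = x,
    while all other terms multiply x on the right by a word containing some k in I, where x ascends.
    Hence evaluation at y has a right inverse ([section_exists]). For y = g this gives projectivity
    ([projective_aux]); for general y it makes essential every epimorphism whose kernel is supported
    on such words ([essential_aux]).

    It remains to find such an epimorphism onto the class module. The runs of the source tableau
    between descents are pieces of rows; turned upright they are the columns of the ribbon, and they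
    are joined into a row exactly where all tableaux of E are forced to ascend ([source_lt],
    [class_att]). So the words of E are admissible ([class_adm]) and carry the same action
    ([class_word_act]). The remaining admissible words are never moved into E ([class_word_lower]),
    so they can be sent to 0. Every admissible word avoiding the letters of I lies in E
    ([class_word_seg]), so the kernel is supported where it should be. *)

Section WeakOrder.
Variable n : nat.
Implicit Types (i j k : 'I_n.-1) (f u : 'S_n).
Local Open Scope group_scope.

Fact lo_subproof i : i < n.
Proof. by case: n i => [[]|m] i //=; apply: leqW. Qed.

Fact hi_subproof i : i.+1 < n.
Proof. by case: n i => [[]|m] i //=; apply: (ltn_ord i). Qed.

Definition lo i : 'I_n := Ordinal (lo_subproof i).
Definition hi i : 'I_n := Ordinal (hi_subproof i).
Definition tr i : 'S_n := tperm (lo i) (hi i).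

Lemma trE i (x : 'I_n) : tr i x = nswap i x :> nat.
Proof.
rewrite /nswap; case: tpermP => [->|->|/eqP + /eqP] /=.
- by rewrite eqxx.
- by rewrite eqxx (gtn_eqF (ltnSn i)).
by rewrite -!val_eqE /= => /negPf -> /negPf ->.
Qed.

Lemma trK i : tr i * tr i = 1. Proof. exact: tperm2. Qed.

Lemma trV i : (tr i)^-1 = tr i. Proof. exact: tpermV. Qed.

Lemma tr_lo i : tr i (lo i) = hi i. Proof. exact: tpermL. Qed.

Lemma tr_hi i : tr i (hi i) = lo i. Proof. exact: tpermR. Qed.

Lemma tr_comm i j : i.+1 < j -> tr i * tr j = tr j * tr i.
Proof. by move=> ij; apply/permP=> x; apply: ord_inj; rewrite !permM !trE -nswapC. Qed.

Lemma tr_braid i j : j = i.+1 :> nat -> tr i * tr j * tr i = tr j * tr i * tr j.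
Proof.
by move=> ij; apply/permP=> x; apply: ord_inj; rewrite !permM !trE ij nswap_braid.
Qed.

(* Permutations compose from left to right: [f * tr i] exchanges the values   *)
(* i and i + 1 of the word f, and [tr k * f] the letters at k and k + 1.      *)
Definition lam i f := if f^-1 (lo i) < f^-1 (hi i) then f * tr i else f.
Definition rho k f := if f (lo k) < f (hi k) then tr k * f else f.

Lemma rhoV k f : rho k f = (lam k f^-1)^-1.
Proof.
by rewrite /lam /rho invgK; case: ifP; rewrite ?invgM ?invgK ?trV.
Qed.

Lemma invM_tr f i x : (f * tr i)^-1 x = f^-1 (tr i x).
Proof. by rewrite invgM permM trV. Qed.

Lemma tr_lt i (x y : 'I_n) : (x, y) != (lo i, hi i) -> (x, y) != (hi i, lo i) ->
  (tr i x < tr i y) = (x < y).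
Proof. rewrite !xpair_eqE -!val_eqE /= !trE => A B; exact: nswap_lt A B. Qed.

(** One exchange alters the test of the other only if the positions k, k + 1 hold the values i, i +
    1. In that case both exchanges are the same permutation, performed once or not at all in either
    order. *)
Lemma rho_lam k i f : rho k (lam i f) = lam i (rho k f).
Proof.
have [[fa fb]|ne1] := altP ((f (lo k), f (hi k)) =P (lo i, hi i)).
  have E : f * tr i = tr k * f.
    apply/permP=> x; rewrite !permM.
    case: (tpermP (lo k) (hi k) x) => [->|->|xl xh].
    - by rewrite fa tr_lo fb.
    - by rewrite fb tr_hi fa.
    by rewrite tpermD // -?fa -?fb; apply/eqP=> /perm_inj/esym.
  have pa : f^-1 (lo i) = lo k by rewrite -fa permK.
  have pb : f^-1 (hi i) = hi k by rewrite -fb permK.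
  have -> : lam i f = f * tr i by rewrite /lam pa pb leqnn.
  have -> : rho k f = f * tr i by rewrite /rho fa fb leqnn E.
  rewrite /rho /lam !permM fa fb !invM_tr tr_lo tr_hi pa pb /=.
  by rewrite !ltnNge !leqnSn.
have [[fa fb]|ne2] := altP ((f (lo k), f (hi k)) =P (hi i, lo i)).
  have -> : lam i f = f by rewrite /lam -fa -fb !permK /= ltnNge leqnSn.
  have -> : rho k f = f by rewrite /rho fa fb /= ltnNge leqnSn.
  by rewrite /lam -fa -fb !permK /= ltnNge leqnSn.
have ne1' : (f^-1 (lo i), f^-1 (hi i)) != (lo k, hi k).
  by apply: contra ne1 => /eqP[<- <-]; rewrite !permKV.
have ne2' : (f^-1 (lo i), f^-1 (hi i)) != (hi k, lo k).
  by apply: contra ne2 => /eqP[<- <-]; rewrite !permKV.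
have E1 : ((f * tr i)%g (lo k) < (f * tr i)%g (hi k)) = (f (lo k) < f (hi k)).
  by rewrite !permM tr_lt.
have E2 : ((tr k * f)^-1%g (lo i) < (tr k * f)^-1%g (hi i)) = (f^-1 (lo i) < f^-1 (hi i)).
  by rewrite invgM trV !permM tr_lt.
rewrite /lam /rho.
by case l: (f^-1 (lo i) < _); case r: (f (lo k) < _);
  rewrite ?E1 ?E2 ?l ?r ?mulgA.
Qed.

(* This is not the Coxeter length: any bounded statistic that increases under *)
(* the effective [lam] and [rho] would do.                                   *)
Definition len f : nat := (\sum_(x : 'I_n) x * (n - f x))%N.

(** The rearrangement inequality for a single pair. *)
Lemma sum_tr_lt i (a b : 'I_n -> nat) : a (lo i) < a (hi i) -> b (hi i) < b (lo i) ->
  (\sum_x a x * b x < \sum_x a (tr i x) * b x)%N.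
Proof.
move=> la lb; have hl : hi i != lo i by rewrite -val_eqE /= gtn_eqF.
have split2 (F : 'I_n -> nat) :
    \sum_x F x = (F (lo i) + F (hi i) + \sum_(x | (x != lo i) && (x != hi i)) F x)%N.
  by rewrite (bigD1 (lo i)) // (bigD1 (hi i)) //= addnA.
rewrite !split2 tr_lo tr_hi [X in _ < _ + X](eq_bigr (fun x => a x * b x))%N.
  by rewrite ltn_add2r; nia.
by move=> x /andP[xl xh]; rewrite /tr tpermD // eq_sym.
Qed.

Lemma len_tr_mul k f : f (lo k) < f (hi k) -> len f < len (tr k * f).
Proof.
move=> lt; rewrite /len [X in _ < X](reindex_inj (@perm_inj _ (tr k))) /=.
under [X in _ < X]eq_bigr do rewrite permM -[tr k (tr k _)]permM trK perm1.
by apply: sum_tr_lt => //=; have := ltn_ord (f (hi k)); lia.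
Qed.

Lemma len_mul_tr i f : f^-1 (lo i) < f^-1 (hi i) -> len f < len (f * tr i).
Proof.
move=> lt; rewrite /len [X in X < _](reindex_inj (@perm_inj _ f^-1)) /=.
rewrite [X in _ < X](reindex_inj (@perm_inj _ (f * tr i)^-1)) /=.
under eq_bigr do rewrite permKV.
under [X in _ < X]eq_bigr do rewrite permKV invM_tr.
by apply: (sum_tr_lt (a := fun x => val (f^-1 x)) (b := fun x => n - x)) => //=;
  have := ltn_ord (hi i) => /=; lia.
Qed.

Lemma leq_len_rho k f : len f <= len (rho k f).
Proof. by rewrite /rho; case: ifP => // /len_tr_mul/ltnW. Qed.

Lemma ltn_len_rho k f : f (lo k) < f (hi k) -> len f < len (rho k f).
Proof. by move=> lt; rewrite /rho lt len_tr_mul. Qed.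

(** Ascents everywhere give x <= f x by induction; both sides have the same sum, so equality holds
    throughout. *)
Lemma asc_perm1 f : (forall k, f (lo k) < f (hi k)) -> f = 1.
Proof.
move=> asc; have le (x : 'I_n) : x <= f x.
  case: x => m; elim: m => [//|m IH] mn.
  have mn' : m < n.-1 by case: (n) mn.
  have -> : Ordinal mn = hi (Ordinal mn') by apply: val_inj.
  apply: leq_ltn_trans (asc (Ordinal mn')).
  by rewrite (_ : lo _ = Ordinal (ltnW mn)) ?IH //; apply: val_inj.
have /leqifP : \sum_(x : 'I_n) x <= \sum_x f x ?= iff [forall x, val x == f x].
  by apply: leqif_sum => x _; split; rewrite ?le.
rewrite [X in _ == X](reindex_inj (@perm_inj _ f^-1)) /=.
under [X in _ == X]eq_bigr do rewrite permKV.
rewrite [X in _ < X](reindex_inj (@perm_inj _ f^-1)) /=.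
under [X in _ < X]eq_bigr do rewrite permKV.
rewrite ltnn; case: ifP => // /forallP fE _.
by apply/permP=> x; rewrite perm1; apply: ord_inj; rewrite -(eqP (fE x)).
Qed.

Definition ldesc i f := f^-1 (hi i) < f^-1 (lo i).

Lemma ldescN i f : ldesc i f = ~~ (f^-1 (lo i) < f^-1 (hi i)).
Proof.
rewrite /ldesc -leqNgt ltn_neqAle andb_idl // => _.
by rewrite (inj_eq val_inj) (inj_eq perm_inj) -val_eqE /= gtn_eqF.
Qed.

Lemma lam_ldesc i f : ldesc i f -> lam i f = f.
Proof. by rewrite ldescN /lam => /negPf ->. Qed.

Lemma ldesc_tr i f : ldesc i (f * tr i) = ~~ ldesc i f.
Proof. by rewrite [ldesc i f]ldescN negbK /ldesc !invM_tr tr_lo tr_hi. Qed.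

Lemma lam_nldesc i f : ~~ ldesc i f -> lam i f = f * tr i.
Proof. by rewrite ldescN negbK /lam => ->. Qed.

Lemma len_ldesc i f : ldesc i f -> len (f * tr i) < len f.
Proof.
move=> d; rewrite -[X in _ < len X](mulgK (tr i)) trV.
by apply: len_mul_tr; rewrite !invM_tr tr_lo tr_hi.
Qed.

Lemma lam_ind (P : 'S_n -> Prop) :
  P 1 -> (forall i u, P u -> P (lam i u)) -> forall u, P u.
Proof.
move=> P1 Pl u; have [m] := ubnP (len u); elim: m u => // m IH u um.
have [/existsP[i d]|/existsPn nd] := boolP [exists i, ldesc i u].
  have -> : u = lam i (u * tr i).
    by rewrite lam_nldesc ?ldesc_tr ?d // -mulgA trK mulg1.
  by apply/Pl/IH/(leq_trans (len_ldesc d)).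
suff -> : u = 1 by [].
apply: invg_inj; rewrite invg1; apply: asc_perm1 => k.
by have := nd k; rewrite ldescN negbK.
Qed.

Lemma ldesc1 i : ~~ ldesc i 1.
Proof. by rewrite /ldesc invg1 !perm1 -leqNgt /=. Qed.

Section Matsumoto.
Variables (A : pzRingType) (p : 'I_n.-1 -> A).
Hypothesis p_idem : forall i, (p i * p i = p i)%R.
Hypothesis p_braid : forall i j, j = i.+1 :> nat -> (p i * p j * p i = p j * p i * p j)%R.
Hypothesis p_comm : forall i j, i.+1 < j -> (p i * p j = p j * p i)%R.

(** The product of the [p i] along a word obtained by peeling off left descents; [m] is fuel, and
    any bound on [len u] suffices. *)
Fixpoint lift_word m u : A :=
  if m is m'.+1 then
    if [pick i | ldesc i u] is Some i then (p i * lift_word m' (u * tr i)%g)%R else 1%R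
  else 1%R.

Lemma lift_word_stable m m' u : len u <= m -> len u <= m' ->
  lift_word m u = lift_word m' u.
Proof.
elim: m m' u => [|m IH] [|m'] u //= um um'.
- by case: pickP => // i /len_ldesc; lia.
- by case: pickP => // i /len_ldesc; lia.
- by case: pickP => // i /len_ldesc lt; congr (_ * _)%R; apply: IH; lia.
Qed.

(** Independence of the descent that is peeled first: by induction, two left descents can be
    completed to the two sides of a commutation or braid relation, with the same remainder. *)
Lemma lift_word_ldesc m u j : len u <= m -> ldesc j u ->
  lift_word m u = (p j * lift_word m (u * tr j)%g)%R.
Proof.
elim: m u j => [|m IH] u j um dj; first by have := len_ldesc dj; lia.
have lj := len_ldesc dj.
rewrite (@lift_word_stable m.+1 m (u * tr j)) /=; [|lia|lia].
case: pickP => [i di|/(_ j)]; last by rewrite dj.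
have li := len_ldesc di.
have [->//|ij] := eqVneq i j.
wlog lt : i j dj lj di li {ij} / i < j => [W|].
  move: ij; rewrite neq_ltn => /orP[lt|lt]; first exact: W.
  by apply: esym; apply: W.
have di' : (u^-1 (hi i) < u^-1 (lo i))%g by [].
have dj' : (u^-1 (hi j) < u^-1 (lo j))%g by [].
have [ij|ij] := ltnP i.+1 j.
  have D (a : 'I_n) : (a != j :> nat) -> (a != j.+1 :> nat) -> tr j a = a.
    by move=> aj aj1; apply: tpermD; rewrite -val_eqE /= eq_sym.
  have D' (a : 'I_n) : (a != i :> nat) -> (a != i.+1 :> nat) -> tr i a = a.
    by move=> aj aj1; apply: tpermD; rewrite -val_eqE /= eq_sym.
  rewrite (IH (u * tr i)%g j) ?(IH (u * tr j)%g i); try lia.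
  - by rewrite !GRing.mulrA p_comm // -!mulgA tr_comm.
  - by rewrite /ldesc !invM_tr !D //=; lia.
  - by rewrite /ldesc !invM_tr !D' //=; lia.
have {ij lt} ij : j = i.+1 :> nat by lia.
have loj : lo j = hi i by apply: val_inj.
have trihj : tr i (hi j) = hi j.
  by apply: tpermD; rewrite -val_eqE /= ij; lia.
have trjli : tr j (lo i) = lo i.
  by apply: tpermD; rewrite -val_eqE /= ?ij; lia.
have trjhi : tr j (hi i) = hi j by rewrite -loj tr_lo.
have trjhj : tr j (hi j) = hi i by rewrite -loj tr_hi.
have trihi : tr i (hi i) = lo i by rewrite tr_hi.
have trili : tr i (lo i) = hi i by rewrite tr_lo.
(* The values i + 2, i + 1, i now occur in this order in u, so all three letters of either side of
   the braid relation can be peeled off. *)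
rewrite loj in dj'.
have d1 : ldesc j (u * tr i)%g.
  by rewrite /ldesc !invM_tr loj trihj trihi; apply: ltn_trans dj' di'.
have d2 : ldesc i (u * tr i * tr j)%g.
  by rewrite /ldesc !invM_tr trjhi trjli trihj trili.
have d3 : ldesc i (u * tr j)%g.
  by rewrite /ldesc !invM_tr trjhi trjli; apply: ltn_trans dj' di'.
have d4 : ldesc j (u * tr j * tr i)%g.
  by rewrite /ldesc !invM_tr loj trihj trihi trjhj trjli.
have l1 := len_ldesc d1; have l3 := len_ldesc d3.
rewrite (IH _ j _ d1) ?(IH _ i _ d2) ?(IH _ i _ d3) ?(IH _ j _ d4); try lia.
rewrite !mulrA p_braid //; congr (_ * lift_word m _)%R.
by rewrite -!mulgA; congr (u * _); rewrite !mulgA tr_braid.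
Qed.

(* Matsumoto's theorem for the 0-Hecke monoid. *)
Lemma matsumoto :
  exists F : 'S_n -> A, F 1 = 1%R /\ forall i u, F (lam i u) = (p i * F u)%R.
Proof.
pose F u := lift_word (len u) u.
have F_ldesc i u : ldesc i u -> F u = (p i * F (u * tr i)%g)%R.
  move=> d; rewrite /F (lift_word_ldesc _ d) //; congr (_ * _)%R.
  by apply: lift_word_stable; have := len_ldesc d; lia.
exists F; split.
  rewrite /F; case: (len _) => //= m; case: pickP => // i.
  by rewrite (negPf (ldesc1 i)).
move=> i u; have [d|nd] := boolP (ldesc i u).
  by rewrite lam_ldesc // (F_ldesc i u d) mulrA p_idem.
by rewrite lam_nldesc // (F_ldesc i) ?ldesc_tr // -mulgA trK mulg1.
Qed.

End Matsumoto.

End WeakOrder.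

(** * Right products, words and parabolic subgroups *)

Section Words.
Variable n : nat.
Implicit Types (i j k : 'I_n.-1) (f u : 'S_n) (ks : seq 'I_n.-1).

Definition rdesc k f := f (hi k) < f (lo k).

Lemma rdescN k f : rdesc k f = ~~ (f (lo k) < f (hi k)).
Proof.
rewrite /rdesc -leqNgt ltn_neqAle andb_idl // => _.
by rewrite (inj_eq val_inj) (inj_eq perm_inj) -val_eqE /= gtn_eqF.
Qed.

Lemma rdescE k f : rdesc k f = (rho k f == f).
Proof.
rewrite rdescN /rho; case: ifP => _; rewrite ?eqxx //.
apply/esym/negbTE; apply/eqP=> /(congr1 (fun g : 'S_n => g (lo k))).
by rewrite permM tr_lo => /perm_inj/(congr1 val) /=; lia.
Qed.

Lemma rho_rdesc k f : rdesc k f -> rho k f = f.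
Proof. by rewrite rdescE => /eqP. Qed.

Lemma rho_nrdesc k f : ~~ rdesc k f -> rho k f = tr k * f.
Proof. by rewrite rdescN negbK /rho => ->. Qed.

Lemma rdesc_tr k f : rdesc k (tr k * f) = ~~ rdesc k f.
Proof. by rewrite [rdesc k f]rdescN negbK /rdesc !permM tr_lo tr_hi. Qed.

Lemma rdesc_rho_tr k f : rdesc k f -> f = rho k (tr k * f).
Proof. by move=> d; rewrite rho_nrdesc ?rdesc_tr ?d // mulgA trK mul1g. Qed.

Lemma rdesc_lam k i f : rdesc k f -> rdesc k (lam i f).
Proof. by rewrite !rdescE rho_lam => /eqP->. Qed.

Lemma nrdesc_len k f : ~~ rdesc k f -> len f < len (rho k f).
Proof. by rewrite rdescN negbK; apply: ltn_len_rho. Qed.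

Lemma nrdesc_eq1 f : (forall k, ~~ rdesc k f) -> f = 1.
Proof. by move=> nd; apply: asc_perm1 => k; rewrite -[_ < _]negbK -rdescN. Qed.

Lemma len_bound f : len f <= n * (n * n).
Proof.
rewrite -[X in (X * _)%N]card_ord -sum_nat_const; apply: leq_sum => x _.
by rewrite leq_mul ?leq_subr // ltnW.
Qed.

Definition rword f ks := foldl (fun f k => rho k f) f ks.
Definition lword ks : 'S_n := foldr (@lam n) 1 ks.

Lemma lam_rword i f ks : lam i (rword f ks) = rword (lam i f) ks.
Proof. by elim: ks f => //= k ks IH f; rewrite IH rho_lam. Qed.

Lemma leq_len_rword f ks : len f <= len (rword f ks).
Proof.
by elim: ks f => //= k ks IH f; apply: leq_trans (IH _); apply: leq_len_rho.
Qed.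

(** As long as the letters are ineffective, f stays the same and still ascends at k; so some letter,
    at the latest k, is effective. *)
Lemma ltn_len_rword k f ks : k \in ks -> ~~ rdesc k f -> len f < len (rword f ks).
Proof.
elim: ks f => //= k' ks IH f; rewrite inE => kks nd.
have [d|nd'] := boolP (rdesc k' f); last first.
  exact: leq_trans (nrdesc_len nd') (leq_len_rword _ _).
rewrite rho_rdesc //; apply: IH => //.
by case/orP: kks => // /eqP ek; move: nd; rewrite ek d.
Qed.

Lemma rword_fix f ks : {in ks, forall k, rdesc k f} -> rword f ks = f.
Proof.
elim: ks f => //= k ks IH f fk; rewrite rho_rdesc ?fk ?mem_head //.
by apply: IH => j jk; rewrite fk // inE jk orbT.
Qed.

(** [rword f ks] is the 0-Hecke product of f and [rword 1 ks], and left factors never destroy right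
    descents. *)
Lemma rdesc_rword k f ks : rdesc k (rword 1 ks) -> rdesc k (rword f ks).
Proof.
move=> d; elim/lam_ind: f => // i f.
by rewrite -lam_rword; apply: rdesc_lam.
Qed.

Lemma lwordV ks : (rword 1 (rev ks))^-1 = lword ks.
Proof.
elim: ks => [|k ks IH]; first exact: invg1.
by rewrite rev_cons -cats1 /rword foldl_cat /= -/(rword _ _) rhoV invgK IH.
Qed.

(* [f] lies in the parabolic subgroup omitting s_k. *)
Definition seg k f := [forall x : 'I_n, (x <= k) == (f x <= k)].

Lemma seg1 k : seg k 1.
Proof. by apply/forallP=> x; rewrite perm1. Qed.

Lemma seg_nrdesc k f : seg k f -> ~~ rdesc k f.
Proof.
move=> /forallP s; have /eqP := s (lo k); have /eqP := s (hi k).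
by rewrite rdescN negbK /= leqnn ltnn; lia.
Qed.

Lemma seg_tr j k f : k != j -> seg j f -> seg j (tr k * f).
Proof.
move=> kj /forallP s; apply/forallP=> x; rewrite permM -(eqP (s _)) trE /nswap.
by move: kj; rewrite -val_eqE /= => /eqP kj; apply/eqP; do 2?case: eqP; lia.
Qed.

Lemma seg_rho j k f : k != j -> seg j f -> seg j (rho k f).
Proof. by move=> kj s; rewrite /rho; case: ifP => // _; apply: seg_tr. Qed.

Lemma seg_rword j f ks : j \notin ks -> seg j f -> seg j (rword f ks).
Proof.
elim: ks f => //= k ks IH f; rewrite inE negb_or eq_sym => /andP[kj jks] s.
by apply: IH => //; apply: seg_rho.
Qed.

(** Peeling off right descents: each lies in K by [seg_nrdesc], and removing it preserves the
    hypothesis. *)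
Lemma rword_exists (K : pred 'I_n.-1) u : (forall k, ~~ K k -> seg k u) ->
  exists2 ks, all K ks & u = rword 1 ks.
Proof.
have [m] := ubnP (len u); elim: m u => // m IH u um su.
have [/existsP[k d]|/existsPn nd] := boolP [exists k, rdesc k u]; last first.
  by exists [::] => //; apply: nrdesc_eq1.
have Kk : K k by apply: contraLR d => /su/seg_nrdesc.
have eu := rdesc_rho_tr d.
have [||ks Kks Eks] := IH (tr k * u).
- have := @nrdesc_len k (tr k * u); rewrite rdesc_tr d -eu => /(_ isT); lia.
- move=> j nKj; apply: seg_tr (su _ nKj).
  by apply: contra nKj => /eqP<-.
exists (rcons ks k); first by rewrite all_rcons Kk.
by rewrite {1}eu Eks /rword foldl_rcons.
Qed.

(* The word found is one of w_0(K). *)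
Lemma w0_exists (K : pred 'I_n.-1) :
  exists2 ks, all K ks & forall k, K k -> rdesc k (rword 1 ks).
Proof.
have: exists2 ks, all K ks & n * (n * n) - len (rword 1 ks) < (n * (n * n)).+1.
  by exists [::]; rewrite // ltnS leq_subr.
elim: (_.+1) => [[ks] //|m IH [ks Kks um]].
have [/existsP[k /andP[Kk nd]]|/existsPn nd] :=
  boolP [exists k, K k && ~~ rdesc k (rword 1 ks)]; last first.
  by exists ks => // k Kk; have := nd k; rewrite Kk /= negbK.
apply: IH; exists (rcons ks k); first by rewrite all_rcons Kk.
have := nrdesc_len nd; have := len_bound (rho k (rword 1 ks)).
by rewrite [rword 1 (rcons _ _)]/rword foldl_rcons -/(rword 1 ks); lia.
Qed.

Lemma left_w0_exists (K : pred 'I_n.-1) :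
  exists2 ks, all K ks & forall k, K k -> ldesc k (lword ks).
Proof.
have [ks Kks d] := w0_exists K; exists (rev ks); first by rewrite all_rev.
by move=> k Kk; have := d k Kk; rewrite -lwordV revK /ldesc invgK.
Qed.

End Words.

(** * Idempotents of the 0-Hecke algebra *)

Section HeckeRelations.
Variables (K : fieldType) (n : nat).
Local Notation H := (hecke K n).
Local Open Scope ring_scope.

Lemma hgen_idem (i : 'I_n.-1) : hgen K i * hgen K i = hgen K i.
Proof. by rewrite hclsM; apply/hclsP/heq_idem. Qed.

Lemma hgen_braid (i j : 'I_n.-1) : j = i.+1 :> nat ->
  hgen K i * hgen K j * hgen K i = hgen K j * hgen K i * hgen K j.
Proof. by move=> ij; rewrite /hgen -!mulrA !hclsM; apply/hclsP; exact: heq_braid. Qed.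

Lemma hgen_comm (i j : 'I_n.-1) : (i.+1 < j)%N ->
  hgen K i * hgen K j = hgen K j * hgen K i.
Proof. by move=> ij; rewrite /hgen !hclsM; apply/hclsP/heq_comm. Qed.

(** [F u] is pi_u. The rule for right products follows from the one for left products by induction,
    because the two commute. *)
Lemma hecke_word : exists F : 'S_n -> H,
  [/\ F 1%g = 1, forall i u, F (lam i u) = hgen K i * F u
    & forall k u, F (rho k u) = F u * hgen K k].
Proof.
have [F [F1 Fl]] := matsumoto hgen_idem hgen_braid hgen_comm.
exists F; split=> // k; elim/lam_ind=> [|i u IH]; last first.
  by rewrite rho_lam !Fl IH mulrA.
have -> : rho k 1%g = lam k 1%g by rewrite rhoV invg1 /lam invg1 !perm1 /= leqnn mul1g trV.
by rewrite Fl F1 mulr1 mul1r.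
Qed.

(** The right side is symmetric in x and y up to its last term, so the braid relation passes from
    the pi_k to the 1 - pi_k. *)
Lemma sink_expand (A : pzRingType) (x y : A) : x * x = x ->
  (1 - x) * (1 - y) * (1 - x) = 1 - x - y + x * y + y * x - x * y * x.
Proof.
move=> xx.
have x1 : (1 - x) * (1 - x) = 1 - x by rewrite mulrBr mulr1 mulrBl mul1r xx subrr subr0.
rewrite [X in X * _]mulrBr mulr1 mulrBl x1 mulrBl mul1r mulrBr mulr1 mulrBl.
by rewrite !opprB !addrA [LHS](ACl (1*2*6*5*3*4)).
Qed.

(* eps is the image of pi_{w_0(I)} under the automorphism pi_k |-> 1 - pi_k.  *)
Lemma hecke_sink (I : pred 'I_n.-1) : exists eps : H,
  (forall k, I k -> hgen K k * eps = 0) /\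
  (forall (M : lmodType H) (y : M), exists z : 'I_n.-1 -> M,
    eps *: y = y + \sum_(k | I k) hgen K k *: z k).
Proof.
pose b (k : 'I_n.-1) : H := 1 - hgen K k.
have bE k c : b k * c = c - hgen K k * c by rewrite mulrBl mul1r.
have [||| G [G1 Gl]] := @matsumoto n H b.
- by move=> i; rewrite bE mulrBr mulr1 hgen_idem subrr subr0.
- move=> i j ij; rewrite /b !sink_expand ?hgen_idem // (hgen_braid ij).
  by rewrite [LHS](ACl (1*3*2*5*4*6)).
- move=> i j ij; rewrite /b !mulrBr !mulr1 !mulrBl !mul1r hgen_comm //.
  by rewrite !opprB !addrA [LHS](ACl (1*4*3*2)).
have [ks Iks dks] := left_w0_exists I.
exists (G (lword ks)); split=> [k Ik|M y].
  apply/eqP; rewrite -oppr_eq0 -(inj_eq (addrI (G (lword ks)))) addr0.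
  by rewrite -bE -Gl lam_ldesc // dks.
elim: ks Iks {dks} => /= [_|k ks IH /andP[Ik Iks]].
  exists (fun=> 0); rewrite G1 scale1r big1 ?addr0 // => k _.
  by rewrite scaler0.
have [z Ez] := IH Iks.
(* The new factor 1 - pi_k adds the term - pi_k (G y), which is absorbed into the coefficient at
   k. *)
exists (fun j => if j == k then z k - G (lword ks) *: y else z j).
rewrite Gl bE scalerBl -scalerA {1}Ez -!addrA; congr (_ + _).
rewrite !(bigD1 k Ik) /= eqxx scalerBr -!addrA; congr (_ + _).
rewrite addrC; congr (_ + _); apply: eq_bigr => j /andP[_ /negPf ->] //.
Qed.

End HeckeRelations.

(** * Homomorphisms out of a spanned module, and unitriangular maps *)

Section SpanHom.
Variables (K : fieldType) (n : nat) (T : finType) (a : hecke_action n T).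
Local Notation H := (hecke K n).
Local Notation V := (hspan K a).
Local Open Scope ring_scope.

Local Notation "c %:H" := ((c : K)%:A : H) (at level 1, format "c %:H").

Lemma hcls_scal (c : K) : hcls (HScal n c) = c%:H.
Proof. by rewrite [RHS]hclsZ; apply/hclsP/heq_sym/heq_mul1r. Qed.

Lemma scalA_comm (c : K) (h : H) (M : lmodType H) (m : M) :
  c%:H *: (h *: m) = h *: (c%:H *: m).
Proof. by rewrite !scalerA mulr_algl mulr_algr. Qed.

Definition span_fun (X : lmodType H) (F : T -> X) (v : V) : X :=
  \sum_x (v x)%:H *: F x.

Lemma span_fun_linear (X : lmodType H) (F : T -> X) :
  (forall i x, hgen K i *: F x = if a i x is Some y then F y else 0) ->
  linear (span_fun F : V -> X).
Proof.
move=> Fa.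
have FD (u v : V) : span_fun F (u + v) = span_fun F u + span_fun F v.
  rewrite -big_split /=; apply: eq_bigr => x _.
  by rewrite -scalerDl -scalerDl ffunE.
suff FZ h (u : V) : span_fun F (h *: u) = h *: span_fun F u.
  by move=> h u v; rewrite FD FZ.
elim/hcls_ind: h => t; elim: t u => [i|c|s IHs t IHt|s IHs t IHt] u.
- rewrite -/(hgen K i) scaler_sumr.
  under [RHS]eq_bigr do rewrite -scalA_comm Fa.
  transitivity (\sum_y \sum_(x | a i x == Some y) (u x)%:H *: F y).
    apply: eq_bigr => y _; rewrite [_ *: u]hsmulE /= ffunE.
    by rewrite -scaler_suml -scaler_suml.
  rewrite (exchange_big_dep xpredT) //=; apply: eq_bigr => x _.
  case: (a i x) => [z|]; last by rewrite big_pred0 ?scaler0.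
  by rewrite (big_pred1 z) // => y; rewrite (inj_eq Some_inj) eq_sym.
- rewrite hcls_scal scaler_sumr; apply: eq_bigr => x _.
  by rewrite hscalarE scalerA mulr_algl scalerA.
- by rewrite -hclsD !scalerDl FD IHs IHt.
- by rewrite -hclsM -!scalerA IHs IHt.
Qed.

Lemma span_hom (X : lmodType H) (F : T -> X) :
  (forall i x, hgen K i *: F x = if a i x is Some y then F y else 0) ->
  exists f : {linear V -> X}, f =1 span_fun F.
Proof.
move=> /span_fun_linear lF.
pose m := GRing.isLinear.Build _ _ _ _ (span_fun F) lF.
pose f : {linear V -> X} := HB.pack (span_fun F) m.
by exists f.
Qed.

Lemma span_fun_basis (X : lmodType H) (F : T -> X) x :
  span_fun F (hbasis K a x) = F x.
Proof.
rewrite /span_fun (bigD1 x) //= big1 => [|y /negPf yx].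
  by rewrite ffunE eqxx !scale1r addr0.
by rewrite ffunE yx !scale0r.
Qed.

Lemma span_decomp (v : V) : v = \sum_x (v x)%:H *: hbasis K a x.
Proof.
apply/ffunP=> y; rewrite sum_ffunE (bigD1 y) //= big1 => [|z /negPf zy].
  by rewrite hscalarE ffunE eqxx mulr1 addr0.
by rewrite hscalarE ffunE eq_sym zy mulr0.
Qed.

Lemma linear_span (X : lmodType H) (f : {linear V -> X}) (v : V) :
  f v = \sum_x (v x)%:H *: f (hbasis K a x).
Proof.
by rewrite {1}[v]span_decomp linear_sum; apply: eq_bigr => x _; rewrite linearZ.
Qed.

Section Unipotent.
Variable len : T -> nat.

Definition above m (v : V) := forall x, (len x < m)%N -> v x = 0.

Lemma above_sum m (I : Type) (r : seq I) (P : pred I) (F : I -> V) :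
  (forall i, P i -> above m (F i)) -> above m (\sum_(i <- r | P i) F i).
Proof.
move=> Fm x xm; rewrite sum_ffunE big1 // => i Pi; exact: Fm.
Qed.

Lemma aboveZ m (c : K) (v : V) : above m v -> above m (c%:H *: v).
Proof. by move=> vm x xm; rewrite hscalarE vm ?mulr0. Qed.

Lemma aboveD m (u v : V) : above m u -> above m v -> above m (u + v).
Proof. by move=> um vm x xm; rewrite ffunE um ?vm ?addr0. Qed.

Lemma above_basis m x : (m <= len x)%N -> above m (hbasis K a x).
Proof.
move=> mx y ym; rewrite ffunE; case: eqP => // yx.
by move: ym; rewrite yx ltnNge mx.
Qed.

(** Successive approximation: replacing g by g + (1 - f g) turns the error w into w - f w, one step
    further in the filtration by [len], which is finite. *)
Lemma unipotent_section (f : {linear V -> V}) :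
  (forall x, above (len x).+1 (f (hbasis K a x) - hbasis K a x)) ->
  exists g : {linear V -> V}, forall v, f (g v) = v.
Proof.
move=> fu.
have step m v : above m v -> above m.+1 (v - f v).
  have E : f v - v = \sum_x (v x)%:H *: (f (hbasis K a x) - hbasis K a x).
    under eq_bigr do rewrite scalerBr.
    by rewrite sumrB -linear_span -span_decomp.
  move=> vm x xm; rewrite -opprB E ffunE (above_sum (m := m.+1)) ?oppr0 // => z _.
  have [zm|zm] := ltnP (len z) m.
    by rewrite vm // scale0r scale0r => y _; rewrite ffunE.
  by apply: aboveZ => y ym; apply: (fu z); apply: leq_trans ym _.
have aprx m : exists g : {linear V -> V}, forall v, above m (v - f (g v)).
  elim: m => [|m [g gP]]; first by exists \0 => v x.
  exists (g \+ (idfun \- (f \o g))) => v /=.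
  by rewrite linearD opprD addrA; apply: step.
have [g gP] := aprx (\max_x len x).+1; exists g => v.
apply/esym/eqP; rewrite -subr_eq0; apply/eqP/ffunP=> x.
by rewrite gP ?ffunE // ltnS leq_bigmax.
Qed.

End Unipotent.
End SpanHom.

(** * Modules spanned by words with prescribed ascents and descents *)

Definition admissible n (I J : pred 'I_n.-1) (u : 'S_n) :=
  [forall k, (I k ==> ~~ rdesc k u) && (J k ==> rdesc k u)].

Section WordModule.
Variables (K : fieldType) (n : nat) (T : finType) (a : hecke_action n T).
Variables (I J : pred 'I_n.-1) (e : T -> 'S_n).
Local Notation H := (hecke K n).
Local Notation V := (hspan K a).
Local Notation adm := (admissible I J).
Local Open Scope ring_scope.
Local Notation "c %:H" := ((c : K)%:A : H) (at level 1, format "c %:H").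

Hypothesis e_inj : injective e.
Hypothesis e_adm : forall x, adm (e x).
Hypothesis e_onto : forall u, adm u -> exists x, e x = u.
Hypothesis e_act : forall i x,
  if a i x is Some y then e y = lam i (e x) else ~~ adm (lam i (e x)).

(** Inadmissible words are sent to 0, so that the action is plain left multiplication
    ([hgen_vec]). *)
Definition vec u : V := if [pick x | e x == u] is Some x then hbasis K a x else 0.

Lemma vec_e x : vec (e x) = hbasis K a x.
Proof.
rewrite /vec; case: pickP => [y /eqP/e_inj ->//|/(_ x)].
by rewrite eqxx.
Qed.

Lemma vec_nadm u : ~~ adm u -> vec u = 0.
Proof.
by move=> nu; rewrite /vec; case: pickP => // x /eqP xu; move: nu; rewrite -xu e_adm.
Qed.

Lemma above_vec m u : (m <= len u)%N -> above (fun x => len (e x)) m (vec u).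
Proof.
rewrite /vec; case: pickP => [x /eqP <-|_ _ x _]; last by rewrite ffunE.
exact: (@above_basis _ _ _ _ (fun x => len (e x))).
Qed.

Definition Jdesc u := forall k, J k -> rdesc k u.

Lemma Jdesc_e x : Jdesc (e x).
Proof. by move=> k Jk; have /forallP/(_ k)/andP[_ /implyP->] := e_adm x. Qed.

Lemma Idesc u : Jdesc u -> ~~ adm u -> exists2 k, I k & rdesc k u.
Proof.
move=> Ju /forallPn[k]; rewrite negb_and (negb_imply (I k)).
rewrite (negb_imply (J k)) negbK => /orP[]/andP[].
  by exists k.
by move/Ju->.
Qed.

Lemma hgen_vec i u : Jdesc u -> hgen K i *: vec u = vec (lam i u).
Proof.
move=> Ju; have [/e_onto[x <-]|nu] := boolP (adm u).
  rewrite vec_e hgenE; have := e_act i x.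
  by case: (a i x) => [y <-|/vec_nadm ->//]; rewrite vec_e.
rewrite !vec_nadm ?scaler0 //.
have [k Ik d] := Idesc Ju nu; apply/negP=> /forallP/(_ k).
by rewrite Ik rdesc_lam.
Qed.

Variable F : 'S_n -> H.
Hypothesis F1 : F 1%g = 1.
Hypothesis F_lam : forall i u, F (lam i u) = hgen K i * F u.
Hypothesis F_rho : forall k u, F (rho k u) = F u * hgen K k.
Variable eps : H.
Hypothesis eps_kill : forall k, I k -> hgen K k * eps = 0.
Hypothesis eps_exp : forall (M : lmodType H) (y : M), exists z : 'I_n.-1 -> M,
  eps *: y = y + \sum_(k | I k) hgen K k *: z k.
Variables (ksg : seq 'I_n.-1) (xg : T).
Hypothesis J_ksg : all J ksg.
Hypothesis e_xg : e xg = rword 1%g ksg.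

(** This trades the left action of pi_f on a word for right products of f with its letters, whose
    effect on the length is controlled by the descents of f. *)
Lemma F_vec f ks : Jdesc (rword 1%g ks) -> F f *: vec (rword 1%g ks) = vec (rword f ks).
Proof.
move=> Jks; elim/lam_ind: f => [|i f IH]; first by rewrite F1 scale1r.
rewrite F_lam -scalerA IH hgen_vec ?lam_rword // => k Jk.
by apply/rdesc_rword/Jks.
Qed.

Definition iota_elt x : H := F (e x) * eps.

(** A product that leaves the admissible words has a descent at some k in I, so pi_k splits off on
    the right and annihilates eps. *)
Lemma iota_elt_act (M : lmodType H) (m : M) i x :
  hgen K i *: (iota_elt x *: m) = if a i x is Some y then iota_elt y *: m else 0.
Proof.
rewrite scalerA /iota_elt mulrA -F_lam; have := e_act i x.
case: (a i x) => [y <-//|nadm].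
have [k Ik d] := Idesc (fun k Jk => rdesc_lam i (@Jdesc_e x k Jk)) nadm.
by rewrite (rdesc_rho_tr d) F_rho -mulrA eps_kill // mulr0 scale0r.
Qed.

Lemma all_rword (u : 'S_n) :
  exists2 ks, u = rword 1%g ks & forall k : 'I_n.-1, ~~ seg k u -> k \in ks.
Proof.
have [//|ks _ E] := @rword_exists _ predT u.
exists ks => // k; apply: contraR => kks; rewrite E; exact: seg_rword (seg1 k).
Qed.

(** A word of pi_k z starts with k, and x ascends at k, so multiplying x by it on the right
    lengthens x. *)
Lemma above_F_hgen x k (v : V) : I k ->
  above (fun x => len (e x)) (len (e x)).+1 (F (e x) *: (hgen K k *: v)).
Proof.
move=> Ik; rewrite {1}[v]span_decomp !scaler_sumr; apply: above_sum => z _.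
rewrite -!scalA_comm; apply: aboveZ; rewrite -vec_e.
have [ks Eks _] := all_rword (e z).
have E : lam k (e z) = rword 1%g (k :: ks).
  by rewrite Eks lam_rword /= rhoV invg1 /lam invg1 !perm1 /= leqnn mul1g trV.
rewrite hgen_vec; last exact: Jdesc_e.
rewrite E F_vec; last by rewrite -E => j /(@Jdesc_e z j); apply: rdesc_lam.
apply: above_vec; apply: ltn_len_rword (mem_head _ _) _.
by have /forallP/(_ k)/andP[/implyP->] := e_adm x.
Qed.

(** The letters of the generator lie in J, where x already descends, so none is effective. *)
Lemma F_gen x : F (e x) *: hbasis K a xg = hbasis K a x.
Proof.
rewrite -!vec_e e_xg F_vec -?e_xg; last exact: Jdesc_e.
by rewrite rword_fix // => k /(allP J_ksg)/(@Jdesc_e x k).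
Qed.

Lemma above_F_basis x z k : I k -> ~~ seg k (e z) ->
  above (fun x => len (e x)) (len (e x)).+1 (F (e x) *: hbasis K a z).
Proof.
move=> Ik nseg; have [ks Eks ksP] := all_rword (e z).
rewrite -vec_e Eks F_vec -?Eks; last exact: Jdesc_e.
apply: above_vec; apply: ltn_len_rword (ksP k nseg) _.
by have /forallP/(_ k)/andP[/implyP->] := e_adm x.
Qed.

(* Evaluation at y of the embedding [iota_elt] is unitriangular. *)
Lemma section_exists (y : V) :
  (forall z, (y - hbasis K a xg) z != 0 -> exists2 k, I k & ~~ seg k (e z)) ->
  exists g : {linear V -> V},
    forall v, v = span_fun (fun x => iota_elt x *: y) (g v).
Proof.
move=> yP; have [f fE] := span_hom (iota_elt_act y).
have [x|g gK] := @unipotent_section _ _ _ a (fun x => len (e x)) f; last first.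
  by exists g => v; rewrite -fE gK.
rewrite fE span_fun_basis /iota_elt -scalerA.
have [z ->] := eps_exp y; rewrite scalerDr addrAC -{1}(F_gen x) -scalerBr.
apply: aboveD; last first.
  by rewrite scaler_sumr; apply: above_sum => k Ik; apply: above_F_hgen.
rewrite [y - _]span_decomp scaler_sumr.
apply: above_sum => t _; rewrite -scalA_comm.
have [y0|/yP[k Ik nseg]] := eqVneq ((y - hbasis K a xg) t) 0.
  by rewrite y0 scale0r scale0r => y' _; rewrite ffunE.
by apply: aboveZ; apply: above_F_basis nseg.
Qed.

(** A preimage m of the image of the generator defines the map x -> pi_x eps m; composed with the
    right inverse of evaluation at the generator, it lifts f. *)
Lemma projective_aux : projective V.
Proof.
move=> M N g f g_surj; have [m mE] := g_surj (f (hbasis K a xg)).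
have [z|p pK] := @section_exists (hbasis K a xg).
  by rewrite subrr ffunE eqxx.
have [h hE] := span_hom (iota_elt_act m).
exists (h \o p) => v /=; rewrite [in RHS](pK v) hE !linear_sum.
apply: eq_bigr => x _; rewrite !linearZ /=; congr (_ *: _).
by rewrite mE.
Qed.

(** If [g x0] and the generator have the same image under f, they differ by a kernel element; so
    evaluation at [g x0] is onto, and its values lie in the image of g. *)
Lemma essential_aux (N : lmodType H) (f : {linear V -> N}) : surj f ->
  (forall v, f v = 0 -> forall z, v z != 0 -> exists2 k, I k & ~~ seg k (e z)) ->
  essential_epi f.
Proof.
move=> f_surj f_ker; split=> // X g fg_surj v.
have [x0 x0E] := fg_surj (f (hbasis K a xg)).
have [|p pK] := @section_exists (g x0).
  by apply: f_ker; rewrite linearB -x0E subrr.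
exists (\sum_x (p v x)%:H *: (iota_elt x *: x0)).
rewrite [RHS]pK linear_sum; apply: eq_bigr => x _.
by rewrite !linearZ.
Qed.

End WordModule.

Section WordModuleTheory.
Variables (K : fieldType) (n : nat) (T : finType) (a : hecke_action n T).
Variables (I J : pred 'I_n.-1) (e : T -> 'S_n).
Hypothesis IJ : forall k, I k -> ~~ J k.
Hypothesis e_inj : injective e.
Hypothesis e_adm : forall x, admissible I J (e x).
Hypothesis e_onto : forall u, admissible I J u -> exists x, e x = u.
Hypothesis e_act : forall i x,
  if a i x is Some y then e y = lam i (e x) else ~~ admissible I J (lam i (e x)).

Lemma generator_exists : exists2 ks, all J ks & exists x, e x = rword 1 ks.
Proof.
have [ks Jks dks] := w0_exists J; exists ks => //; apply: e_onto.
apply/forallP=> k; apply/andP; split; apply/implyP; last exact: dks.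
move=> Ik; apply/seg_nrdesc/seg_rword/seg1; apply/negP=> /(allP Jks).
exact/negP/IJ.
Qed.

Lemma word_projective : projective (hspan K a).
Proof.
have [F [F1 Fl Fr]] := hecke_word K n; have [eps [ek ee]] := hecke_sink K I.
have [ks Jks [xg Exg]] := generator_exists.
apply: (projective_aux e_inj e_adm e_onto e_act F1 Fl Fr ek ee Jks Exg).
Qed.

Lemma word_essential (N : lmodType (hecke K n)) (f : {linear hspan K a -> N}) :
  surj f ->
  (forall v, f v = 0%R -> forall z, v z != 0%R -> exists2 k, I k & ~~ seg k (e z)) ->
  essential_epi f.
Proof.
have [F [F1 Fl Fr]] := hecke_word K n; have [eps [ek ee]] := hecke_sink K I.
have [ks Jks [xg Exg]] := generator_exists.
move=> fs fk; exact: (essential_aux e_inj e_adm e_onto e_act F1 Fl Fr ek ee Jks Exg fs fk).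
Qed.

End WordModuleTheory.

(** * Fillings as words *)

Section Labelling.
Variables (D : seq box) (n : nat).
Variables (phi : 'I_n -> seq_sub D) (phi' : seq_sub D -> 'I_n).
Hypotheses (phiK : cancel phi phi') (phiK' : cancel phi' phi).
Implicit Types (f : filling D n) (u : 'S_n) (p : 'I_n).

Definition word_of f : 'S_n :=
  insubd (1 : 'S_n) [ffun p => insubd p (f (phi p)).-1].

Lemma word_ofE f p : standard f -> (word_of f p).+1 = f (phi p).
Proof.
move=> sf; have lt q : (f (phi q)).-1 < n.
  by have := ltn_ord (f (phi q)); have := standard_gt0 (phi q) sf; lia.
have vE q : insubd q (f (phi q)).-1 = (f (phi q)).-1 :> nat.
  by rewrite val_insubd lt.
have inj : injectiveb [ffun p => insubd p (f (phi p)).-1 : 'I_n].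
  apply/injectiveP=> q r; rewrite !ffunE => /(congr1 (@nat_of_ord n)); rewrite !vE => qr.
  apply/(can_inj phiK)/(standard_inj sf).
  by have := standard_gt0 (phi q) sf; have := standard_gt0 (phi r) sf; lia.
rewrite -pvalE val_insubd inj ffunE vE prednK //.
exact: standard_gt0.
Qed.

Lemma word_of_inj f f' : standard f -> standard f' -> word_of f = word_of f' -> f = f'.
Proof.
move=> sf sf' E; apply/ffunP=> b; apply: ord_inj.
by rewrite -(phiK' b) -!word_ofE // E.
Qed.

Definition fill_of u : filling D n := [ffun b => inord (u (phi' b)).+1].

Lemma fill_ofE u b : fill_of u b = (u (phi' b)).+1 :> nat.
Proof. by rewrite ffunE inordK ?ltnS ?ltn_ord. Qed.

Lemma fill_of_standard u : standard (fill_of u).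
Proof.
apply: uniq_perm; [|exact: iota_uniq|].
- rewrite map_inj_uniq ?enum_uniq // => b c; rewrite !fill_ofE => -[].
  by move=> /ord_inj/perm_inj/(can_inj phiK').
move=> x; rewrite mem_iota; apply/imageP/idP=> [[b _ ->]|].
  by rewrite fill_ofE add1n /= !ltnS ltn_ord.
case: x => // x; rewrite add1n /= ltnS => xn.
exists (phi (u^-1 (Ordinal xn))) => //.
by rewrite fill_ofE phiK permKV.
Qed.

Lemma fill_ofK u : word_of (fill_of u) = u.
Proof.
apply/permP=> p; apply: ord_inj; apply: succn_inj.
by rewrite word_ofE ?fill_of_standard // fill_ofE phiK.
Qed.

Lemma box_of_perm f (v : 'I_n) : standard f ->
  box_of f v.+1 = ssval (phi ((word_of f)^-1 v)).
Proof. by move=> sf; apply: box_ofE; rewrite // -word_ofE // permKV. Qed.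

Lemma word_of_swap (i : 'I_n.-1) f : standard f ->
  word_of (swap i.+1 f) = word_of f * tr i.
Proof.
move=> sf; apply/permP=> p; apply: ord_inj; apply: succn_inj.
have i_n : i.+1 < n by apply: hi_subproof.
rewrite word_ofE ?standard_swap // swapE // permM trE -word_ofE //.
by rewrite /nswap !eqSS; do 2?case: ifP.
Qed.

End Labelling.

(** * Standard ribbon tableaux as admissible words *)

Definition ribbon_step (x y : box) : bool :=
  [|| y == (x.1, x.2.+1), y == (x.1.+1, x.2) | (x.1 < y.1) && (x.2 < y.2)].

Section RibbonWords.
Variables (n : nat) (A : seq (seq nat)).
Local Notation D := (grd A).
Hypothesis sizeD : size D = n.
Hypothesis stepD : sorted ribbon_step D.

Definition cell (p : nat) : box := nth (0, 0) D p.

Lemma cell_step p : p.+1 < n -> ribbon_step (cell p) (cell p.+1).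
Proof. by move=> pn; apply: (sortedP (0, 0) stepD); rewrite sizeD. Qed.

(** Each step weakly increases both coordinates and strictly increases their sum. *)
Lemma cell_lt p q : p < q -> q < n ->
  [/\ (cell p).1 <= (cell q).1, (cell p).2 <= (cell q).2 & cell p != cell q].
Proof.
move=> pq qn; pose R (x y : box) := [&& x.1 <= y.1, x.2 <= y.2 & x.1 + x.2 < y.1 + y.2].
have R_tr : transitive R by move=> y x z /and3P[? ? ?] /and3P[? ? ?]; apply/and3P; split; lia.
have sR : sorted R D.
  apply: sub_sorted stepD => x y /or3P[/eqP ->|/eqP->|/andP[? ?]];
  by apply/and3P; split=> /=; lia.
have /and3P[le1 le2 lt] : R (cell p) (cell q).
  by apply: (sorted_ltn_nth R_tr (0, 0) sR) => //; rewrite inE sizeD // (ltn_trans pq).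
by split=> //; apply/eqP=> E; move: lt; rewrite -/(cell p) -/(cell q) E ltnn.
Qed.

Lemma uniqD : uniq D.
Proof.
apply/(uniqP (0, 0)) => p q; rewrite !inE sizeD => pn qn E.
have [lt|lt|//] := ltngtP p q.
  by have [_ _ /eqP[]] := cell_lt lt qn.
by have [_ _ /eqP[]] := cell_lt lt pn.
Qed.

Fact cell_subproof (p : 'I_n) : cell p \in D.
Proof. by apply: mem_nth; rewrite sizeD. Qed.

Fact cell_index_subproof (b : seq_sub D) : index (ssval b) D < n.
Proof. by rewrite -sizeD index_mem; apply: valP. Qed.

Definition rphi p := SeqSub (cell_subproof p).
Definition rphi' b := Ordinal (cell_index_subproof b).

Lemma rphiK : cancel rphi rphi'.
Proof. by move=> p; apply: val_inj; rewrite /= index_uniq ?sizeD ?uniqD. Qed.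

Lemma rphiK' : cancel rphi' rphi.
Proof. by move=> b; apply: val_inj; rewrite /= /cell nth_index //; apply: valP. Qed.

Definition rowI : pred 'I_n.-1 := fun k => (cell k).1 == (cell k.+1).1.
Definition colJ : pred 'I_n.-1 := fun k => (cell k).2 == (cell k.+1).2.

Lemma rowI_colJ k : rowI k -> ~~ colJ k.
Proof.
rewrite /rowI /colJ; have := cell_step (hi_subproof k).
by case: (cell k) (cell k.+1) => [a b] [c d] /or3P[/eqP[-> ->]|/eqP[-> ->]|/andP[/=]] /=; lia.
Qed.

Lemma adm_row u (p q : 'I_n) : admissible rowI colJ u -> p < q ->
  (cell p).1 = (cell q).1 -> u p < u q.
Proof.
move=> /forallP au; case: q => q; elim: q => //= q IH qn; rewrite ltnS => pq row.
have qn1 : q < n.-1 by rewrite ltn_predRL.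
have [/= le1 _ _] := @cell_lt q q.+1 (leqnn _) qn.
have Iq : rowI (Ordinal qn1).
  apply/eqP=> /=; move: pq; rewrite leq_eqVlt => /predU1P[e|pq]; first by rewrite -row e.
  by have [? _ _] := cell_lt pq (ltnW qn); lia.
have := au (Ordinal qn1); rewrite Iq rdescN negbK => /andP[lt _].
have Eh : hi (Ordinal qn1) = Ordinal qn by apply: val_inj.
have El : lo (Ordinal qn1) = Ordinal (ltnW qn) by apply: val_inj.
rewrite Eh El in lt; move: pq; rewrite leq_eqVlt => /predU1P[pq|pq].
  by rewrite (_ : p = Ordinal (ltnW qn)) //; apply: val_inj.
by apply: ltn_trans lt; apply: IH => //; rewrite row; apply/esym/eqP.
Qed.

Lemma adm_col u (p q : 'I_n) : admissible rowI colJ u -> p < q ->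
  (cell p).2 = (cell q).2 -> u q < u p.
Proof.
move=> /forallP au; case: q => q; elim: q => //= q IH qn; rewrite ltnS => pq col.
have qn1 : q < n.-1 by rewrite ltn_predRL.
have [/= _ le2 _] := @cell_lt q q.+1 (leqnn _) qn.
have Jq : colJ (Ordinal qn1).
  apply/eqP=> /=; move: pq; rewrite leq_eqVlt => /predU1P[e|pq]; first by rewrite -col e.
  by have [_ ? _] := cell_lt pq (ltnW qn); lia.
have := au (Ordinal qn1); rewrite Jq /rdesc => /andP[_ lt].
have Eh : hi (Ordinal qn1) = Ordinal qn by apply: val_inj.
have El : lo (Ordinal qn1) = Ordinal (ltnW qn) by apply: val_inj.
rewrite Eh El in lt; move: pq; rewrite leq_eqVlt => /predU1P[pq|pq].
  by rewrite (_ : p = Ordinal (ltnW qn)) //; apply: val_inj.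
by apply: ltn_trans lt _; apply: IH => //; rewrite col; apply/esym/eqP.
Qed.

Lemma is_srt_word (f : filling D n) : standard f ->
  is_srt f = admissible rowI colJ (word_of rphi f).
Proof.
move=> sf; rewrite /is_srt sf /=; apply/andP/idP => [[/forallP rf /forallP cf]|au].
  apply/forallP=> k.
  have := forallP (rf (rphi (lo k))) (rphi (hi k)).
  have := forallP (cf (rphi (hi k))) (rphi (lo k)) => /=.
  rewrite rdescN negbK /rowI /colJ -!(word_ofE rphiK) // !ltnS.
  move: (cell_step (hi_subproof k)); case: (cell k) (cell k.+1) => [x1 x2] [y1 y2].
  case/or3P=> [/eqP[-> ->]|/eqP[-> ->]|/andP[/= lt1 lt2]] /=;
    rewrite ?eqxx ?ltnSn ?ltnn ?andbF /=.
  - by rewrite ltn_eqF //= andbT => _ ->.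
  - by rewrite ltn_eqF //= => + _; rewrite -leqNgt => /ltnW.
  by rewrite (ltn_eqF lt1) (ltn_eqF lt2).
have fE b : f b = (word_of rphi f (rphi' b)).+1 :> nat.
  by rewrite (word_ofE rphiK) // rphiK'.
have cE b : ssval b = cell (rphi' b) by rewrite -[in LHS](rphiK' b).
split; apply/forallP=> b; apply/forallP=> c; apply/implyP; rewrite !cE !fE ltnS;
  move=> /andP[/eqP E lt].
- apply: adm_row => //; rewrite ltnNge leq_eqVlt; apply/negP=> /predU1P[/ord_inj eq|lt'].
    by rewrite eq ltnn in lt.
  by have [_ + _] := cell_lt lt' (ltn_ord _); lia.
apply: adm_col => //; rewrite ltnNge leq_eqVlt; apply/negP=> /predU1P[/ord_inj eq|lt'].
  by rewrite eq ltnn in lt.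
by have [+ _ _] := cell_lt lt' (ltn_ord _); lia.
Qed.

Definition srt_word (t : srt n A) : 'S_n := word_of rphi (val t).

Lemma srt_word_inj : injective srt_word.
Proof.
move=> t u E; apply/val_inj/(word_of_inj rphiK rphiK' _ _ E);
  exact: srt_standard (valP _).
Qed.

Lemma srt_word_adm t : admissible rowI colJ (srt_word t).
Proof. by rewrite -is_srt_word ?(valP t) //; apply: srt_standard (valP t). Qed.

Lemma srt_word_onto u : admissible rowI colJ u -> exists t, srt_word t = u.
Proof.
move=> au; have su := fill_of_standard rphiK rphiK' u.
have tu : is_srt (fill_of rphi' u) by rewrite is_srt_word // (fill_ofK rphiK rphiK').
by exists (Sub _ tu); rewrite /srt_word SubK; exact: (fill_ofK rphiK rphiK').
Qed.

(** Higher boxes are read later. So i strictly above i + 1 is a left descent; in one row the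
    exchange would break the row; otherwise i is read first and the exchange is the effective
    product. *)
Lemma srt_word_act i t : if srt_hecke n A i t is Some t'
  then srt_word t' = lam i (srt_word t)
  else ~~ admissible rowI colJ (lam i (srt_word t)).
Proof.
have st := srt_standard (valP t); have at_ := srt_word_adm t.
have E1 : box_of (val t) i.+1 = cell ((srt_word t)^-1 (lo i)).
  exact: (box_of_perm rphiK (lo i) st).
have E2 : box_of (val t) i.+2 = cell ((srt_word t)^-1 (hi i)).
  exact: (box_of_perm rphiK (hi i) st).
rewrite /= /srt_act; case: ifPn => [|na].
  rewrite E1 E2 /strictly_above => lt; rewrite lam_ldesc // /ldesc ltnNge leq_eqVlt.
  apply/negP=> /predU1P[/ord_inj eq|lt']; first by rewrite eq ltnn in lt.
  by have [+ _ _] := cell_lt lt' (ltn_ord _); lia.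
set P := (srt_word t)^-1 (lo i) in E1 *; set Q := (srt_word t)^-1 (hi i) in E2 *.
have uP : srt_word t P = lo i by rewrite permKV.
have uQ : srt_word t Q = hi i by rewrite permKV.
have lamE : P < Q -> lam i (srt_word t) = srt_word t * tr i by rewrite /lam => ->.
have PQ : P != Q by rewrite (inj_eq perm_inj) -val_eqE /= neq_ltn leqnn.
case: ifPn => [|ns].
  rewrite E1 E2 /same_row => /eqP row.
  have [lt|lt] := ltnP P Q.
    rewrite lamE //; apply/negP=> /adm_row/(_ lt row).
    by rewrite !permM uP uQ tr_lo tr_hi /= ltnNge leqnSn.
  have {}lt : Q < P by rewrite ltn_neqAle lt andbT eq_sym.
  by have := adm_row at_ lt (esym row); rewrite uP uQ /= ltnNge leqnSn.
have i_n : 0 < i.+1 < n by rewrite /= hi_subproof.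
rewrite /srt_word val_insubd is_srt_swap ?(valP t) // (word_of_swap rphiK) //.
rewrite -/(srt_word t) lamE // ltnNge leq_eqVlt; apply/negP=> /predU1P[/ord_inj eq|lt].
  by rewrite eq eqxx in PQ.
have [+ _ _] := cell_lt lt (ltn_ord _).
by move: na ns; rewrite E1 E2 /strictly_above /same_row; lia.
Qed.

End RibbonWords.

(** * Ribbon diagrams *)

Local Open Scope nat_scope.

Section RibbonGeometry.
Implicit Types (b : seq nat) (A : seq (seq nat)) (x : box).

Definition column x c : seq box := [seq (x.1 + i, x.2) | i <- iota 0 c].

Lemma size_column x c : size (column x c) = c.
Proof. by rewrite size_map size_iota. Qed.

Lemma columnS x c : column x c.+1 = x :: column (x.1.+1, x.2) c.
Proof.
rewrite /column /= addn0 -surjective_pairing -add1n iotaDl -map_comp.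
by congr cons; apply: eq_map => i /=; rewrite addnA addn1.
Qed.

Lemma leq_size_sumn b : 0 \notin b -> size b <= sumn b.
Proof.
elim: b => //= h b IH; rewrite inE negb_or => /andP[h0 /IH]; lia.
Qed.

Lemma rd_from_cat r c b1 b2 : 0 \notin b1 ->
  rd_from r c (b1 ++ b2) =
  rd_from r c b1 ++ rd_from (r + size b1) (c + (sumn b1 - size b1)) b2.
Proof.
elim: b1 r c => [|h b1 IH] r c /=; first by rewrite subnn !addn0.
rewrite inE negb_or => /andP[h0 b0]; rewrite IH // catA.
by have le := leq_size_sumn b0; congr (_ ++ rd_from _ _ _); lia.
Qed.

Lemma rd_from_column r c k : rd_from r c (nseq k 1) = column (r, c) k.
Proof. by elim: k r c => //= k IH r c; rewrite IH columnS !addn0. Qed.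

Lemma last_rd_from x0 r c b : b != [::] -> 0 \notin b ->
  last x0 (rd_from r c b) = (r + (size b).-1, c + (sumn b - size b)).
Proof.
case/lastP: b => // b h _; rewrite mem_rcons inE negb_or => /andP[h0 b0].
rewrite -cats1 rd_from_cat // last_cat /= cats0; case: h h0 => // h _.
rewrite -addn1 iotaD map_cat last_cat /= size_cat sumn_cat /= add0n.
by have le := leq_size_sumn b0; congr pair; lia.
Qed.

(** The last row gains the first box of the new column, and the other boxes are stacked above that
    box. *)
Lemma rd_from_near x0 r c b k : b != [::] -> 0 \notin b ->
  rd_from r c (near_concat b (nseq k.+1 1)) =
  rd_from r c b ++
    column ((last x0 (rd_from r c b)).1, (last x0 (rd_from r c b)).2.+1) k.+1.
Proof.
move=> b1 b0; rewrite last_rd_from //.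
case/lastP: b b1 b0 => // b h _; rewrite mem_rcons inE negb_or => /andP[h0 b0].
rewrite /near_concat last_rcons size_rcons /= -cats1 take_size_cat //.
rewrite !rd_from_cat // -catA /= ?size_cat sumn_cat /= cats0 rd_from_column columnS.
rewrite iotaD map_cat -catA /= add0n; congr (_ ++ (_ ++ _ :: column (_, _) _)).
  by have le := leq_size_sumn b0; congr pair; lia.
by have := leq_size_sumn b0; lia.
Qed.

Definition rib_ok b := (b != [::]) && (0 \notin b).

Lemma near_concat_ok b k : rib_ok b -> rib_ok (near_concat b (nseq k.+1 1)).
Proof.
case/lastP: b => // b h /andP[_]; rewrite mem_rcons inE negb_or => /andP[h0 b0].
rewrite /near_concat last_rcons size_rcons /= -cats1 take_size_cat // /rib_ok.
rewrite mem_cat inE !negb_or b0 /= mem_nseq andbF addn1 /= andbT.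
by case: (b).
Qed.

Definition grd_off x A : box :=
  foldl (fun x b => (x.1 + size b, x.2 + (sumn b - size b).+1)) x A.

Lemma grd_from_rcons r c A b : grd_from r c (rcons A b) =
  grd_from r c A ++ rd_from (grd_off (r, c) A).1 (grd_off (r, c) A).2 b.
Proof. by elim: A r c => [|b' A IH] r c /=; rewrite ?cats0 // IH catA. Qed.

Lemma grd_rcons A c : A != [::] -> all rib_ok A -> exists x,
  [/\ grd (rcons A (nseq c 1)) = grd A ++ column x c,
      (last (0, 0) (grd A)).1 < x.1 & (last (0, 0) (grd A)).2 < x.2].
Proof.
case/lastP: A => // A b _; rewrite all_rcons => /andP[/andP[b1 b0] _].
exists (grd_off (0, 0) (rcons A b)).
rewrite /grd grd_from_rcons rd_from_column -surjective_pairing; split=> //.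
all: rewrite grd_from_rcons last_cat last_rd_from // /grd_off foldl_rcons /=.
  by case: b b1 {b0} => //= h b; lia.
by lia.
Qed.

Lemma grd_gnear A c : A != [::] -> all rib_ok A ->
  grd (gnear_concat A (nseq c.+1 1)) =
  grd A ++ column ((last (0, 0) (grd A)).1, (last (0, 0) (grd A)).2.+1) c.+1.
Proof.
case/lastP: A => // A b _; rewrite all_rcons => /andP[/andP[b1 b0] _].
rewrite /gnear_concat last_rcons size_rcons /= -(cats1 A b) take_size_cat // cats1.
by rewrite /grd !grd_from_rcons last_cat -catA -rd_from_near.
Qed.

Lemma gnear_ok A c : A != [::] -> all rib_ok A ->
  all rib_ok (gnear_concat A (nseq c.+1 1)).
Proof.
case/lastP: A => // A b _; rewrite all_rcons => /andP[b_ok A_ok].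
rewrite /gnear_concat last_rcons size_rcons /= -(cats1 A b) take_size_cat //.
by rewrite all_rcons near_concat_ok.
Qed.

Lemma nth_column x c i : i < c -> nth (0, 0) (column x c) i = (x.1 + i, x.2).
Proof. by move=> ic; rewrite (nth_map 0) ?size_iota // nth_iota. Qed.

End RibbonGeometry.

(** * The ribbon diagram of the source tableau *)

Section AlphaSource.
Variables (n : nat) (alpha : seq nat) (sigma : 'S_(size alpha)).
Variable t : spct n sigma.
Hypothesis n0 : 0 < n.

Definition mergesat (i : nat) := merges t (index i (Des t)).+1.

(** Position y of the box read after the i-th box x, counted from 1: above it inside a run, to its
    right at a merged descent, in a new component otherwise. *)
Definition joint (i : nat) (x y : box) : bool :=
  if i \notin Des t then y == (x.1.+1, x.2)
  else if mergesat i then y == (x.1, x.2.+1)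
  else (x.1 < y.1) && (x.2 < y.2).

Lemma Des_sorted : sorted ltn (Des t).
Proof. by apply: sorted_filter; [apply: ltn_trans | apply: iota_ltn_sorted]. Qed.

Lemma mem_Des i : i \in Des t = (0 < i < n) && descent t i.
Proof. by rewrite mem_filter mem_iota andbC; congr (_ && _); lia. Qed.

Lemma dseq_last : dseq t (size (Des t)).+1 = n.
Proof. by rewrite /dseq nth_default. Qed.

Lemma dseqS j : j < size (Des t) -> dseq t j.+1 \in Des t.
Proof. exact: mem_nth. Qed.

Lemma dseq_lt j : j <= size (Des t) -> dseq t j < dseq t j.+1.
Proof.
move=> jm; case: (ltngtP j (size (Des t))) jm => // [jm|->] _.
  case: j jm => [|j] jm.
    by have := dseqS jm; rewrite mem_Des => /andP[/andP[]].
  by apply: (sortedP n Des_sorted).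
rewrite dseq_last; case E: (size _) => [//|m].
by have := @dseqS m; rewrite E mem_Des leqnn => /(_ isT)/andP[/andP[]].
Qed.

Lemma dseq_le i j : i <= j -> j <= (size (Des t)).+1 -> dseq t i <= dseq t j.
Proof.
elim: j => [|j IH]; first by rewrite leqn0 => /eqP->.
rewrite leq_eqVlt => /predU1P[->//|ij] jm.
exact: leq_trans (IH ij (ltnW jm)) (ltnW (dseq_lt jm)).
Qed.

Lemma dseq_between j k : j <= size (Des t) -> dseq t j < k < dseq t j.+1 ->
  k \notin Des t.
Proof.
move=> jm /andP[jk kj]; apply/negP=> kD.
have Ek : dseq t (index k (Des t)).+1 = k by rewrite /dseq /= nth_index.
have km : index k (Des t) < size (Des t) by rewrite index_mem.
have [ij|ij] := leqP (index k (Des t)).+1 j.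
  by have := dseq_le ij (leqW jm); lia.
by have := dseq_le ij (leqW km); lia.
Qed.

Lemma alpha_uptoP j : j <= size (Des t) ->
  [/\ alpha_upto t j != [::], all rib_ok (alpha_upto t j),
      size (grd (alpha_upto t j)) = dseq t j.+1
    & forall k, k.+1 < dseq t j.+1 ->
        joint k.+1 (nth (0, 0) (grd (alpha_upto t j)) k)
                   (nth (0, 0) (grd (alpha_upto t j)) k.+1)].
Proof.
elim: j => [|j IH] jm.
  have d1 := dseq_lt jm; split=> //=.
  - by rewrite andbT /rib_ok mem_nseq andbF andbT; case: (dseq t 1) d1.
  - by rewrite /grd /= cats0 rd_from_column size_column.
  move=> k kd; rewrite /grd /= cats0 rd_from_column !nth_column ?(ltnW kd) //.
  by rewrite /joint (@dseq_between 0) //= addnS.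
have [nil ok sz jt] := IH (ltnW jm).
have lt := dseq_lt jm; set c := (dseq t j.+2 - dseq t j.+1).-1.
have Ec : dseq t j.+2 - dseq t j.+1 = c.+1 by rewrite /c; lia.
have dD := dseqS jm.
have idx : index (dseq t j.+1) (Des t) = j.
  by rewrite /dseq /= index_uniq // (sorted_uniq ltn_trans ltnn Des_sorted).
have [x [Egrd Ex]] : exists x, grd (alpha_upto t j.+1) = grd (alpha_upto t j) ++ column x c.+1
     /\ joint (dseq t j.+1) (last (0, 0) (grd (alpha_upto t j))) x.
  rewrite /joint dD /= /mergesat idx Ec; case: ifP => _.
    by rewrite grd_gnear //; eexists; split; first by []; apply: eqxx.
  have [x [Ex lt1 lt2]] := grd_rcons c.+1 nil ok.
  by exists x; rewrite Ex lt1 lt2.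
split.
- by rewrite /=; case: ifP => _; [|case: alpha_upto] => //; rewrite /gnear_concat; case: take.
- rewrite /= Ec; case: ifP => _; first exact: gnear_ok.
  by rewrite all_rcons ok andbT /rib_ok /= inE mem_nseq andbF.
- by rewrite Egrd size_cat sz size_column; lia.
move=> k kd; rewrite Egrd !nth_cat sz.
have [k1|k1] := ltnP k.+1 (dseq t j.+1); first by rewrite (ltnW k1) jt.
have [k2|k2] := ltnP k (dseq t j.+1).
  have Ek : k.+1 = dseq t j.+1 by lia.
  rewrite Ek subnn nth_column // addn0 -surjective_pairing.
  by rewrite (_ : k = (size (grd (alpha_upto t j))).-1) ?nth_last // sz -Ek.
rewrite !nth_column; try lia.
by rewrite subSn // addnS /joint (@dseq_between j.+1) ?kd ?ltnS ?k2 /=.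
Qed.

End AlphaSource.

Section AlphaJoints.
Variables (n : nat) (alpha : seq nat) (sigma : 'S_(size alpha)).
Variable t : spct n sigma.

Lemma alpha_source_joints : size (grd (alpha_source t)) = n /\
  forall k, k.+1 < n -> joint t k.+1 (nth (0, 0) (grd (alpha_source t)) k)
                                   (nth (0, 0) (grd (alpha_source t)) k.+1).
Proof.
(* For n = 0 the only summand is empty, a case that [alpha_uptoP] excludes. *)
have [n0|n0] := posnP n.
  have e0 : n.-1 = 0 by lia.
  have D0 : Des t = [::] by rewrite /Des e0.
  split=> [|k kn]; last by lia.
  by rewrite /alpha_source D0 /= /dseq D0 /grd /= cats0 rd_from_column size_column.
have [_ _ sz jt] := alpha_uptoP n0 (leqnn (size (Des t))).
by rewrite dseq_last in sz jt.
Qed.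

(* Joint k lies between the positions k and k + 1, numbered from 0, hence     *)
(* after the entry k + 1 of the source tableau.                              *)
Definition splice_joint : pred 'I_n.-1 := fun k => (k.+1 \in Des t) && mergesat t k.+1.
Definition run_joint : pred 'I_n.-1 := fun k => k.+1 \notin Des t.

Lemma alpha_source_step : sorted ribbon_step (grd (alpha_source t)).
Proof.
have [sz jt] := alpha_source_joints; apply/(sortedP (0, 0)) => k; rewrite sz => /jt.
rewrite /joint /ribbon_step; case: ifP => _; first by move->; rewrite orbT.
by case: ifP => _ ->; rewrite ?orbT.
Qed.

Lemma alpha_source_rowI : @rowI n (alpha_source t) =1 splice_joint.
Proof.
move=> k; have [sz jt] := alpha_source_joints; have := jt k (hi_subproof k).
rewrite /joint /rowI /splice_joint /cell; case: ifPn => /= [/negPf ->|/negPn ->].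
  by move/eqP->; rewrite /= ltn_eqF.
case: ifP => _ /=; first by move/eqP->; rewrite eqxx.
by case/andP=> lt _; rewrite ltn_eqF.
Qed.

Lemma alpha_source_colJ : @colJ n (alpha_source t) =1 run_joint.
Proof.
move=> k; have [sz jt] := alpha_source_joints; have := jt k (hi_subproof k).
rewrite /joint /colJ /run_joint /cell; case: ifPn => /= [_|_].
  by move/eqP->; rewrite /= eqxx.
case: ifP => _ /=; first by move/eqP->; rewrite ltn_eqF.
by case/andP=> _ lt; rewrite ltn_eqF.
Qed.

End AlphaJoints.

(** * Equivalence classes of tableaux *)

Section SpctFillings.
Variables (n : nat) (alpha : seq nat) (sigma : 'S_(size alpha)).
Implicit Types (f h : filling (cd alpha) n) (b c d : seq_sub (cd alpha)).

Lemma mem_cd x : (x \in cd alpha) = (x.1 < size alpha) && (x.2 < nth 0 alpha x.1).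
Proof.
apply/allpairsPdep/andP => [[i [j []]]|[h1 h2]].
  by rewrite !mem_iota /= !add0n => ? ? ->.
by exists x.1, x.2; rewrite !mem_iota /= !add0n -surjective_pairing.
Qed.

(** Standardization records how many letters are smaller; the count for c under h includes all those
    for b, and b itself. *)
Lemma std_mono f h k b c : standard f -> standard h ->
  std (col_word f k) = std (col_word h k) -> (ssval b).2 = k -> (ssval c).2 = k ->
  h b < h c -> f b < f c.
Proof.
move=> sf sh + bk ck; rewrite /col_word; set rows := [seq _ <- _ | _].
have E f' : std [seq entry f' (r, k) | r <- rows] =
    [seq count (fun r' => entry f' (r', k) < entry f' (r, k)) rows | r <- rows].
  by rewrite /std -map_comp; apply: eq_map => r /=; rewrite count_map.
rewrite !E => /eq_in_map cE lt.
have row_in d : (ssval d).2 = k -> (ssval d).1 \in rows.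
  move=> dk; rewrite mem_filter -dk -surjective_pairing (valP d) mem_iota /=.
  by have := valP d; rewrite mem_cd => /andP[].
have eE f' d : (ssval d).2 = k -> entry f' ((ssval d).1, k) = f' d.
  by move=> <-; rewrite -surjective_pairing entryE.
have cb := cE _ (row_in b bk); have cc := cE _ (row_in c ck).
rewrite !eE // in cb cc; rewrite ltnNge; apply/negP=> le.
suff : count (fun r' => entry h (r', k) < h b) rows <
       count (fun r' => entry h (r', k) < h c) rows.
  rewrite -cb -cc ltnNge => /negP; apply; apply: sub_count => r /= ltr.
  exact: leq_trans ltr le.
set P := fun r' => entry h (r', k) < h b; pose Q r' := entry h (r', k) == h b.
have : 0 < count Q rows.
  by rewrite -has_count; apply/hasP; exists (ssval b).1; rewrite ?row_in /Q ?eE.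
have := count_predUI P Q rows; rewrite [X in _ + X](eq_count (a2 := pred0)).
  rewrite count_pred0 addn0 => E' Q0; apply: leq_trans (_ : count (predU P Q) rows <= _).
    by rewrite E'; lia.
  by apply: sub_count => r /orP[|/eqP->] // /ltn_trans; apply.
by move=> r /=; apply/negbTE/negP=> /andP[+ /eqP eq]; rewrite /P eq ltnn.
Qed.

Lemma std_eq f h k : 
  (forall b c, (ssval b).2 = k -> (ssval c).2 = k -> (f b < f c) = (h b < h c)) ->
  std (col_word f k) = std (col_word h k).
Proof.
move=> fh; rewrite /col_word /std -!map_comp; apply/eq_in_map => r.
rewrite mem_filter => /andP[rk _] /=; rewrite !count_map; apply/eq_in_count => r'.
rewrite mem_filter => /andP[r'k _] /=.
by have := fh (SeqSub r'k) (SeqSub rk) erefl erefl; rewrite -!entryE.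
Qed.

Lemma row_decr f b c : is_spct sigma f -> (ssval b).1 = (ssval c).1 ->
  (ssval b).2 < (ssval c).2 -> f c < f b.
Proof.
case/and4P=> _ _ /forallP/(_ b)/forallP/(_ c)/implyP rf _ rbc cbc.
by apply: rf; rewrite rbc eqxx.
Qed.

Lemma spct_triple f b c : is_spct sigma f -> (ssval b).1 < (ssval c).1 ->
  (ssval c).2 = (ssval b).2.+1 -> f c < f b ->
  exists2 d, ssval d = ((ssval b).1, (ssval c).2) & f c < f d.
Proof.
case/and4P=> _ _ _ /forallP/(_ b)/forallP/(_ c)/implyP tf rbc cbc lt.
have /existsP[d /andP[/eqP dE dlt]] := tf ltac:(by rewrite rbc cbc eqxx lt).
by exists d.
Qed.

(* The tableaux of a class are the linear extensions of a poset.             *)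
Lemma spct_linext f h : is_spct sigma h -> standard f ->
  (forall b c, h b < h c ->
     (ssval b == ((ssval c).1, (ssval c).2.+1)) || attacking (ssval b) (ssval c) ->
     f b < f c) ->
  is_spct sigma f /\ forall k, std (col_word f k) = std (col_word h k).
Proof.
move=> th sf fh; have sh := spct_standard th.
have colE b c : (ssval b).2 = (ssval c).2 -> (f b < f c) = (h b < h c).
  move=> bc; case: (ltngtP (h b) (h c)) => [lt|gt|eq].
  - by apply: fh => //; rewrite attacking_eq ?orbT.
  - by apply/negbTE; rewrite -leqNgt ltnW // fh // attacking_eq ?orbT.
  by rewrite (standard_inj sh eq) ltnn.
have stdE k : std (col_word f k) = std (col_word h k).
  by apply: std_eq => b c bk ck; rewrite colE ?bk ?ck.
split=> //; apply/and4P; split=> //.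
- by rewrite stdE; case/and4P: th.
- apply/forallP=> b; apply/forallP=> c; apply/implyP=> /andP[/eqP row lt].
  have [k Ek] : exists k, (ssval c).2 = (ssval b).2 + k.+1.
    by exists ((ssval c).2 - (ssval b).2).-1; lia.
  elim: k c row Ek {lt} => [|k IH] c row Ek.
    apply: fh; first by apply: row_decr; rewrite // Ek addn1.
    by rewrite row -addn1 -Ek -surjective_pairing eqxx.
  have dP : ((ssval b).1, (ssval b).2 + k.+1) \in cd alpha.
    by have := valP c; rewrite !mem_cd /= row Ek => /andP[-> lt] /=;
       apply: leq_ltn_trans lt; rewrite leq_add2l.
  apply: ltn_trans (IH (SeqSub dP) erefl erefl).
  apply: fh; first by apply: row_decr; rewrite //= Ek ltn_add2l.
  by rewrite /= row -addnS -Ek -surjective_pairing eqxx.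
apply/forallP=> b; apply/forallP=> c; apply/implyP=> /and3P[rbc /eqP cbc lt].
have [lth|] := ltnP (h c) (h b).
  have [d dE ltd] := spct_triple th rbc cbc lth.
  by apply/existsP; exists d; rewrite dE eqxx colE // dE.
rewrite leq_eqVlt => /predU1P[/(standard_inj sh) eq|ltbc].
  by rewrite eq ltnn in lt.
have : f b < f c by apply: fh => //; rewrite /attacking rbc cbc eqxx !orbT.
by lia.
Qed.

End SpctFillings.

Lemma leq_nth_sumn s r : nth 0 s r <= sumn s.
Proof.
elim: s r => [|a s IH] [|r] //=; first exact: leq_addr.
exact: leq_trans (IH r) (leq_addl _ _).
Qed.

Section ClassColumns.
Variables (n : nat) (alpha : seq nat) (sigma : 'S_(size alpha)).
Hypothesis halpha : is_comp n alpha.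

Lemma cd_col_lt (b : seq_sub (cd alpha)) : (ssval b).2 < n.
Proof.
have := valP b; rewrite mem_cd => /andP[_ lt].
by apply: leq_trans lt _; case/andP: halpha => _ /eqP <-; apply: leq_nth_sumn.
Qed.

Lemma spct_equivP (t u : spct n sigma) :
  reflect (forall k, std (col_word (val t) k) = std (col_word (val u) k)) (spct_equiv t u).
Proof.
apply: (iffP forallP) => [tu k|tu k]; last by rewrite tu.
have [kn|kn] := ltnP k n; first by have /eqP := tu (Ordinal kn).
by apply: std_eq => b c bk _; have := cd_col_lt b; rewrite bk ltnNge kn.
Qed.

End ClassColumns.

Section ClassOrder.

(** * Inequalities forced on a whole class *)

Variables (n : nat) (alpha : seq nat) (sigma : 'S_(size alpha)).
Variable t : spct n sigma.
Local Notation bx := (box_of (val t)).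

Lemma label_ex v : 0 < v <= n ->
  exists b : seq_sub (cd alpha), ssval b = bx v /\ val t b = v :> nat.
Proof.
move=> vn; have [b bv] := standard_onto (spct_standard (valP t)) vn.
by exists b; rewrite (box_ofE (spct_standard (valP t)) bv).
Qed.

Lemma Des_col v : v \in Des t -> (bx v).2 <= (bx v.+1).2.
Proof. by rewrite mem_filter => /andP[]. Qed.

Variable f : filling (cd alpha) n.
Hypothesis f_spct : is_spct sigma f.
Hypothesis f_equiv : forall k, std (col_word f k) = std (col_word (val t) k).
Local Notation F v := (entry f (bx v)).

Lemma class_same_col v w : 0 < v -> v < w -> w <= n -> (bx v).2 = (bx w).2 -> F v < F w.
Proof.
move=> v0 vw wn E.
have [b [bE tb]] := label_ex (v := v) ltac:(lia).
have [c [cE tc]] := label_ex (v := w) ltac:(lia).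
rewrite -bE -cE !entryE; apply: (std_mono (h := val t) (k := (bx v).2)).
- exact: spct_standard f_spct.
- exact: spct_standard (valP t).
- exact: f_equiv.
- by rewrite bE.
- by rewrite cE.
by rewrite tb tc.
Qed.

(** If the lower right entry were smaller in f, the triple rule would give a box right of v with a
    larger entry than w in the same column. Column orders agree with those of t, so in t the row of
    v would yield w < v. *)
Lemma class_att v w : 0 < v -> v < w -> w <= n -> attacking (bx v) (bx w) -> F v < F w.
Proof.
move=> v0 vw wn; rewrite /attacking => /orP[/eqP E|/andP[/eqP E lt]].
  exact: class_same_col.
have [b [bE tb]] := label_ex (v := v) ltac:(lia).
have [c [cE tc]] := label_ex (v := w) ltac:(lia).
rewrite -bE -cE !entryE ltnNge leq_eqVlt; apply/negP=> /predU1P[|ltf].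
  move/(standard_inj (spct_standard f_spct)) => cb.
  by move: vw; rewrite -tb -tc cb ltnn.
have [||d dE ltd] := spct_triple f_spct _ _ ltf; [by rewrite bE cE | by rewrite bE cE|].
have ltd' : val t c < val t d.
  apply: (std_mono (h := f) (k := (ssval c).2)) => //.
  - exact: spct_standard (valP t).
  - exact: spct_standard f_spct.
  - by rewrite dE.
have : val t d < val t b.
  by apply: row_decr (valP t) _ _; rewrite dE //= bE cE E.
by move: ltd'; rewrite tb tc; lia.
Qed.

End ClassOrder.

Section Source.
Variables (n : nat) (alpha : seq nat) (sigma : 'S_(size alpha)).
Variable t : spct n sigma.
Local Notation bx := (box_of (val t)).
Hypothesis t_source : is_source t.

Lemma source_run v : 0 < v < n -> v \notin Des t ->
  bx v = ((bx v.+1).1, (bx v.+1).2.+1).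
Proof.
move=> vn vD; have /allP/(_ v) := t_source; rewrite mem_iota.
by rewrite (_ : 1 <= v < 1 + n.-1) => [/(_ isT)|]; [rewrite vD => /eqP | lia].
Qed.

Lemma source_col v : 0 < v < n -> (bx v).2 <= (bx v.+1).2.+1.
Proof.
move=> vn; have [|vD] := boolP (v \in Des t).
  by move/Des_col/leqW.
by rewrite source_run.
Qed.

Lemma source_ivt v w x : 0 < v -> v <= w -> w <= n -> (bx w).2 <= x <= (bx v).2 ->
  exists2 r, v <= r <= w & (bx r).2 = x.
Proof.
move=> v0 vw wn; have [d] := ubnP (w - v); elim: d v v0 vw => // d IH v v0 vw dv.
case/andP=> wx; rewrite leq_eqVlt => /predU1P[->|xv].
  by exists v; rewrite ?leqnn.
have {}vw : v < w by rewrite ltn_neqAle vw andbT; apply/eqP=> vw'; move: wx; rewrite -vw'; lia.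
have c : (bx v).2 <= (bx v.+1).2.+1 by apply: source_col; rewrite v0 (leq_trans vw).
have [||||r vr rx] := IH v.+1 => //; first by lia.
  by rewrite wx -ltnS (leq_trans xv).
by exists r => //; lia.
Qed.

Variable f : filling (cd alpha) n.
Hypothesis f_spct : is_spct sigma f.
Hypothesis f_equiv : forall k, std (col_word f k) = std (col_word (val t) k).
Local Notation F v := (entry f (bx v)).

Lemma source_run_lt v : 0 < v < n -> v \notin Des t -> F v < F v.+1.
Proof.
move=> vn /(source_run vn) E.
have [b [bE tb]] := label_ex t (v := v) ltac:(lia).
have [c [cE tc]] := label_ex t (v := v.+1) ltac:(lia).
by rewrite -bE -cE !entryE; apply: row_decr f_spct _ _; rewrite bE cE E.
Qed.

Lemma source_lt v w : 0 < v -> v < w -> w <= n -> (bx w).2 <= (bx v).2 -> F v < F w.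
Proof.
move=> v0 vw wn; have [d] := ubnP (w - v); elim: d v v0 vw => // d IH v v0 vw dv.
rewrite leq_eqVlt => /predU1P[E|lt]; first exact: (class_same_col f_spct f_equiv).
have [vD|vD] := boolP (v \in Des t).
  (* The source moves left one column at a time, so that the column of v is   *)
  (* met again before w.                                                      *)
  have le := Des_col vD.
  have [|r /andP[vr rw] rE] := @source_ivt v.+1 w (bx v).2 isT vw wn.
    by rewrite le (ltnW lt).
  apply: ltn_trans (class_same_col f_spct f_equiv v0 vr (leq_trans rw wn) (esym rE)) _.
  have {}rw : r < w.
    by rewrite ltn_neqAle rw andbT; apply/eqP=> E; move: lt; rewrite -rE E ltnn.
  by apply: IH => //; rewrite ?rE ?(ltnW lt) //; lia.
have vn : 0 < v < n by rewrite v0 (leq_trans vw).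
have lt1 := source_run_lt vn vD.
have := vw; rewrite leq_eqVlt => /predU1P[<-//|vw1].
apply: ltn_trans lt1 (IH _ _ vw1 _ _) => //; first by lia.
by move: lt; rewrite (source_run vn vD) /= ltnS.
Qed.

(** Otherwise f takes a value strictly in between: at v + 1 inside a run, or where the source meets
    the column of v again after a descent. *)
Lemma source_cover v w : 0 < v -> v < w -> w <= n -> (bx w).2 < (bx v).2 ->
  F w = (F v).+1 -> w = v.+1 /\ v \notin Des t.
Proof.
move=> v0 vw wn lt cov.
have vn : 0 < v < n by rewrite v0 (leq_trans vw).
have [vD|vD] := boolP (v \in Des t).
  have le := Des_col vD.
  have [|r /andP[vr rw] rE] := @source_ivt v.+1 w (bx v).2 isT vw wn.
    by rewrite le (ltnW lt).
  have lt1 := class_same_col f_spct f_equiv v0 vr (leq_trans rw wn) (esym rE).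
  have {}rw : r < w.
    by rewrite ltn_neqAle rw andbT; apply/eqP=> E; move: lt; rewrite -rE E ltnn.
  have lt2 : F r < F w by apply: source_lt => //; rewrite ?rE ?(ltnW lt) //; lia.
  by lia.
split=> //; apply/eqP; rewrite eqn_leq vw andbT leqNgt; apply/negP=> vw1.
have lt1 := source_run_lt vn vD.
have lt2 : F v.+1 < F w.
  by apply: source_lt => //; move: lt; rewrite (source_run vn vD) /= ltnS.
by lia.
Qed.

End Source.

(** * Matching ribbon positions with tableau boxes *)

Section RunWords.
Variables (n : nat) (runp : pred 'I_n.-1).
Implicit Types (u : 'S_n) (p q : 'I_n) (k : 'I_n.-1).

Lemma joint_before p q : p < q -> exists k, [/\ hi k = q, p <= lo k & lo k = q.-1 :> nat].
Proof.
move=> pq; have kn : q.-1 < n.-1 by have := ltn_ord q; lia.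
by exists (Ordinal kn); split; [apply: val_inj|..] => /=; lia.
Qed.

Lemma all_or_none p q :
  (forall k : 'I_n.-1, p <= k < q -> runp k) \/ exists2 k : 'I_n.-1, p <= k < q & ~~ runp k.
Proof.
have [/existsP[k /andP[kpq nk]]|/existsPn all] :=
  boolP [exists k : 'I_n.-1, (p <= k < q) && ~~ runp k].
  by right; exists k.
by left=> k kpq; have := all k; rewrite kpq negbK.
Qed.

Lemma run_desc u p q : (forall k, runp k -> rdesc k u) -> p < q ->
  (forall k : 'I_n.-1, p <= k < q -> runp k) -> u q < u p.
Proof.
move=> du; have [m] := ubnP (q : nat); elim: m q => // m IH q qm pq rn.
have [k [Ek le Elo]] := joint_before pq.
have lt : u q < u (lo k) by rewrite -Ek; apply/du/rn; rewrite -[k : nat]/(lo k : nat) le Elo; lia.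
move: le; rewrite leq_eqVlt => /predU1P[/ord_inj-> //|pk].
apply: ltn_trans lt (IH _ _ pk _); first by rewrite Elo; lia.
by move=> j /andP[pj jk]; apply: rn; rewrite pj; lia.
Qed.

Lemma seg_lt u p q k : p <= k < q -> seg k u -> u p <= k < u q.
Proof.
move=> /andP[pk kq] /forallP s; rewrite -(eqP (s p)) pk ltnNge -(eqP (s q)).
by rewrite -ltnNge.
Qed.

End RunWords.

Section Positions.
Variables (n : nat) (alpha : seq nat) (sigma : 'S_(size alpha)).
Variable t : spct n sigma.
Local Notation bx := (box_of (val t)).
Local Notation run := (run_joint t).
Local Notation splice := (splice_joint t).
Implicit Types (u : 'S_n) (p q : 'I_n) (k : 'I_n.-1).

Variable g : 'S_n.
Hypothesis g_desc : forall k, run k -> rdesc k g.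
Hypothesis g_seg : forall k, ~~ run k -> seg k g.
(* [phi p] is the box of cd(alpha) matched with the p-th box of the ribbon    *)
(* diagram; the source tableau t is matched with the word g = w_0(run).      *)
Variable phi : 'I_n -> seq_sub (cd alpha).
Hypothesis t_phi : forall p, val t (phi p) = (g p).+1 :> nat.

Lemma pos_box p : ssval (phi p) = bx (g p).+1.
Proof. by rewrite (box_ofE (spct_standard (valP t)) (t_phi p)). Qed.

Lemma pos_entry (f : filling (cd alpha) n) p : f (phi p) = entry f (bx (g p).+1) :> nat.
Proof. by rewrite -pos_box entryE. Qed.

(** g decreases along runs and increases across all other joints, so no value fits between those at
    a run joint, and a descent there would put the larger value later. *)
Lemma run_label k : run k -> (g (lo k) = (g (hi k)).+1 :> nat) /\
  (g (hi k)).+1 \notin Des t.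
Proof.
move=> rk; have lt := g_desc rk; rewrite /rdesc in lt.
have E : g (lo k) = (g (hi k)).+1 :> nat.
  apply/eqP; rewrite eqn_leq lt andbT leqNgt; apply/negP=> lt2.
  have vn : (g (hi k)).+1 < n by apply: ltn_trans lt2 _.
  pose v := Ordinal vn; pose r := (g^-1)%g v.
  have gr : g r = v by rewrite permKV.
  have rlo : r != lo k by apply: contraTneq lt2 => rE; rewrite -[(g _).+1]/(v : nat) -gr rE ltnn.
  have rhi : r != hi k.
    by apply/eqP=> rE; have := congr1 val gr; rewrite rE /= => /eqP; rewrite ltn_eqF.
  have [rl|rl] := ltnP r (lo k).
    have [rn|[j rj nj]] := all_or_none run r (lo k).
      by have := run_desc g_desc rl rn; rewrite gr /=; lia.
    have /= := @seg_lt _ g r (hi k) j _ (g_seg nj); rewrite gr /=.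
    by move: rj => /= /andP[-> jk] /(_ ltac:(lia)); lia.
  have {}rl : hi k < r.
    move: rl rlo rhi; rewrite -!val_eqE /=; lia.
  have [rn|[j rj nj]] := all_or_none run (hi k) r.
    by have := run_desc g_desc rl rn; rewrite gr /=; lia.
  have /= := @seg_lt _ g (lo k) r j _ (g_seg nj); rewrite gr /=.
  by move: rj => /= /andP[kj ->] /(_ ltac:(lia)); lia.
split=> //; apply/negP=> D; have kn : g (hi k) < n.-1.
  by have := ltn_ord (g (lo k)); rewrite E; lia.
have /forallP s : seg (Ordinal kn) g by apply: g_seg; rewrite /run_joint negbK.
by have /eqP := s (lo k); have /eqP := s (hi k); rewrite /= E leqnn ltnn; lia.
Qed.

(** Since g reverses the runs, the run ending at position k has last label d_j + 1 and the next run
    has first label d_(j+2), where d_(j+1) = k + 1. This is the pair tested by [merges]. *)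
Lemma mergesat_box k : ~~ run k -> mergesat t k.+1 =
  weakly_right (ssval (phi (lo k))) (ssval (phi (hi k))) ||
  attacking (ssval (phi (lo k))) (ssval (phi (hi k))).
Proof.
move=> nk; have kD : k.+1 \in Des t by move: nk; rewrite negbK.
have n0 : 0 < n by have := hi_subproof k; lia.
set j := index k.+1 (Des t).
have jm : j < size (Des t) by rewrite index_mem.
have dj : dseq t j.+1 = k.+1 by rewrite /dseq /= nth_index.
have d1 : dseq t j < k.+1 by rewrite -dj; apply: dseq_lt (ltnW jm).
have d2 : k.+1 < dseq t j.+2 by rewrite -dj; apply: dseq_lt.
have d2n : dseq t j.+2 <= n by rewrite -[X in _ <= X](dseq_last t); apply: dseq_le.
have seg_dseq i (i_n : (dseq t i).-1 < n.-1) : 0 < i <= size (Des t) ->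
    seg (Ordinal i_n) g.
  case: i i_n => // i i_n im; apply: g_seg; rewrite /run_joint negbK /=.
  by have dD := dseqS im; rewrite prednK //; move: dD; rewrite mem_Des // => /andP[/andP[]].
have run_btw i (l : 'I_n.-1) : i <= size (Des t) -> dseq t i < l.+1 < dseq t i.+1 -> run l.
  by move=> im; apply: dseq_between.
have Elo : (g (lo k)).+1 = (dseq t j).+1.
  have vn : dseq t j < n by have := hi_subproof k; lia.
  pose r := (g^-1)%g (Ordinal vn); have gr : g r = Ordinal vn by rewrite permKV.
  have low (p : 'I_n) : (dseq t j <= p) = (dseq t j <= g p).
    have [d0|d0] := posnP (dseq t j); first by rewrite d0.
    have i_n : (dseq t j).-1 < n.-1 by lia.
    have j0 : 0 < j by move: d0; rewrite /dseq; case: (j).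
    have /forallP/(_ p)/eqP/= := seg_dseq j i_n ltac:(lia).
    by lia.
  have rk : r <= k.
    have /forallP/(_ r)/eqP -> := g_seg nk; rewrite gr /=; lia.
  move: rk; rewrite leq_eqVlt => /predU1P[rk|rk].
    by rewrite (_ : lo k = r) ?gr //; apply: val_inj.
  have : g (lo k) < g r.
    apply: (run_desc g_desc) => // l /= /andP[rl lk]; apply: (run_btw j); first exact: ltnW.
    by have := low r; rewrite gr /= leqnn dj; lia.
  by have := low (lo k); rewrite gr /=; lia.
have Ehi : (g (hi k)).+1 = dseq t j.+2.
  have vn : (dseq t j.+2).-1 < n by lia.
  pose r := (g^-1)%g (Ordinal vn); have gr : g r = Ordinal vn by rewrite permKV.
  have high (p : 'I_n) : (p < dseq t j.+2) = (g p < dseq t j.+2).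
    move: d2n; rewrite leq_eqVlt => /predU1P[->|lt]; first by rewrite !ltn_ord.
    have i_n : (dseq t j.+2).-1 < n.-1 by lia.
    have jm2 : j.+1 < size (Des t).
      rewrite ltn_neqAle jm andbT; apply/eqP=> E.
      by move: lt; rewrite E (dseq_last t) ltnn.
    have /forallP/(_ p)/eqP/= := seg_dseq j.+2 i_n jm2.
    by lia.
  have rk : k < r.
    by rewrite ltnNge; have /forallP/(_ r)/eqP -> := g_seg nk; rewrite gr /=; lia.
  move: rk; rewrite leq_eqVlt => /predU1P[rk|rk].
    by rewrite (_ : hi k = r) ?gr /= ?prednK //; [lia | apply: val_inj].
  have : g r < g (hi k).
    apply: (run_desc g_desc) => // l /= /andP[rl lk]; apply: (run_btw j.+1) => //.
    by have := high r; rewrite gr /= dj; lia.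
  by have := high (hi k); rewrite gr /=; lia.
by rewrite !pos_box Elo Ehi.
Qed.

Hypothesis t_source : is_source t.

Lemma run_box k : run k ->
  ssval (phi (hi k)) = ((ssval (phi (lo k))).1, (ssval (phi (lo k))).2.+1).
Proof.
move=> /run_label[E D]; rewrite !pos_box E; apply: source_run => //.
by have := ltn_ord (g (lo k)); rewrite E.
Qed.

(** A run joint moves one column to the right, and an unmerged descent at least one, since there the
    weakly-right test fails. *)
Lemma nonsplice_col p q : p < q -> (forall k : 'I_n.-1, p <= k < q -> ~~ splice k) ->
  (ssval (phi p)).2 + (q - p) <= (ssval (phi q)).2.
Proof.
have [m] := ubnP (q : nat); elim: m q => // m IH q qm pq ns.
have [k [Ek le Elo]] := joint_before pq.
have lt : (ssval (phi (lo k))).2 < (ssval (phi q)).2.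
  rewrite -Ek; have [rk|nk] := boolP (run k); first by rewrite run_box.
  have : ~~ splice k by apply: ns; rewrite -[k : nat]/(lo k : nat) le Elo; lia.
  rewrite /splice_joint mergesat_box //; move: nk; rewrite negbK => -> /=.
  by rewrite negb_or /weakly_right -ltnNge => /andP[].
move: le; rewrite leq_eqVlt => /predU1P[pk|pk].
  by move: lt; rewrite (ord_inj pk); lia.
have := IH _ _ pk _; rewrite Elo => /(_ ltac:(lia)).
have pk' : forall k0 : 'I_n.-1, p <= k0 < q.-1 -> ~~ splice k0.
  by move=> j /andP[pj jk]; apply: ns; rewrite pj; lia.
by move=> /(_ pk'); lia.
Qed.

End Positions.

(** * The words of a class *)

Section ClassWords.
Variables (n : nat) (alpha : seq nat) (sigma : 'S_(size alpha)).
Hypothesis halpha : is_comp n alpha.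

Lemma class_equiv (E : spct_class n sigma) (t u : spct n sigma) :
  t \in val E -> (u \in val E) = spct_equiv t u.
Proof.
have /imsetP[x _ ->] := valP E; rewrite !inE /= => /forallP xt.
by apply/forallP/forallP=> h c; have := h c; rewrite (eqP (xt c)).
Qed.

Variable E : spct_class n sigma.
Variable t : spct n sigma.
Hypothesis tE : t \in val E.
Hypothesis t_source : is_source t.
Local Notation bx := (box_of (val t)).
Local Notation run := (run_joint t).
Local Notation splice := (splice_joint t).
Implicit Types (u : 'S_n) (p q : 'I_n) (k : 'I_n.-1) (s : spct n sigma).

Variable g : 'S_n.
Hypothesis g_desc : forall k, run k -> rdesc k g.
Hypothesis g_seg : forall k, ~~ run k -> seg k g.
Variables (phi : 'I_n -> seq_sub (cd alpha)) (phi' : seq_sub (cd alpha) -> 'I_n).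
Hypotheses (phiK : cancel phi phi') (phiK' : cancel phi' phi).
Hypothesis t_phi : forall p, val t (phi p) = (g p).+1 :> nat.

Definition spct_word s : 'S_n := word_of phi (val s).

Lemma spct_wordE s p : (spct_word s p).+1 = val s (phi p).
Proof. exact/(word_ofE phiK)/spct_standard/valP. Qed.

Lemma spct_word_inj : injective spct_word.
Proof.
move=> s s' eq; apply/val_inj/(word_of_inj phiK phiK' _ _ eq);
  exact: spct_standard (valP _).
Qed.

Lemma class_std s : s \in val E ->
  forall c : nat, std (col_word (val s) c) = std (col_word (val t) c).
Proof. by rewrite (class_equiv _ tE) => /(spct_equivP halpha) st k; rewrite st. Qed.

Lemma label_lt s p q : s \in val E -> g p < g q ->
  (ssval (phi q)).2 <= (ssval (phi p)).2 \/ attacking (ssval (phi p)) (ssval (phi q)) ->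
  spct_word s p < spct_word s q.
Proof.
move=> sE lt rel; rewrite -ltnS !spct_wordE !(pos_entry t_phi).
move: rel; rewrite !(pos_box t_phi).
by case=> ?; [apply: (source_lt t_source (valP s) (class_std sE))
  | apply: (class_att (valP s) (class_std sE))]; rewrite ?ltnS.
Qed.

Lemma word_desc s k : s \in val E -> run k -> rdesc k (spct_word s).
Proof.
move=> sE rk; have := run_box g_desc g_seg t_phi t_source rk => Eb.
rewrite /rdesc -ltnS !spct_wordE; apply: (row_decr (valP s)); by rewrite Eb.
Qed.

Lemma nonrun_lt p q k : p <= k < q -> ~~ run k -> g p < g q.
Proof. by move=> kpq nk; have := seg_lt kpq (g_seg nk); lia. Qed.

Lemma class_adm s : s \in val E -> admissible splice run (spct_word s).
Proof.
move=> sE; apply/forallP=> k; apply/andP; split; apply/implyP; last exact: word_desc.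
case/andP=> kD; have nk : ~~ run k by rewrite negbK.
rewrite (mergesat_box g_desc g_seg t_phi nk) => /orP mg.
rewrite rdescN negbK; apply: label_lt => //.
by apply: (nonrun_lt (k := k)) => //=; rewrite ?leqnn ?ltnSn.
Qed.

(** Positions that g inverts belong to one run, where u decreases as well. *)
Lemma word_lt_swap u p q : (forall k, run k -> rdesc k u) -> g p < g q -> q < p -> u p < u q.
Proof.
move=> du gpq qp; have [rn|[k kqp nk]] := all_or_none run q p.
  exact: run_desc rn.
by have := nonrun_lt kqp nk; lia.
Qed.

Lemma class_fill u : (forall p q, g p < g q ->
    (ssval (phi p) == ((ssval (phi q)).1, (ssval (phi q)).2.+1)) ||
      attacking (ssval (phi p)) (ssval (phi q)) -> u p < u q) ->
  exists2 s, s \in val E & spct_word s = u.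
Proof.
move=> uP; have sf := fill_of_standard phiK phiK' u.
have [|sp st] := spct_linext (valP t) sf.
  move=> b c; rewrite -(phiK' b) -(phiK' c) !t_phi ltnS !fill_ofE !phiK ltnS.
  exact: uP.
exists (Sub _ sp); last by rewrite /spct_word SubK (fill_ofK phiK phiK').
rewrite (class_equiv _ tE); apply/(spct_equivP halpha) => k.
by rewrite SubK st.
Qed.

Lemma class_rel s p q : s \in val E -> g p < g q ->
  (ssval (phi p) == ((ssval (phi q)).1, (ssval (phi q)).2.+1)) ||
    attacking (ssval (phi p)) (ssval (phi q)) -> spct_word s p < spct_word s q.
Proof.
move=> sE lt /orP[/eqP eq|att]; apply: label_lt => //; last by right.
by left; rewrite eq /=.
Qed.

Lemma class_word_act i s : s \in val E ->
  if spct_act i s is Some s' then spct_word s' = lam i (spct_word s)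
  else forall s', s' \in val E -> spct_word s' != lam i (spct_word s).
Proof.
move=> sE; have st := spct_standard (valP s).
have E1 : box_of (val s) i.+1 = ssval (phi ((spct_word s)^-1%g (lo i))).
  exact: (box_of_perm phiK (lo i) st).
have E2 : box_of (val s) i.+2 = ssval (phi ((spct_word s)^-1%g (hi i))).
  exact: (box_of_perm phiK (hi i) st).
set P := (spct_word s)^-1%g (lo i) in E1 *; set Q := (spct_word s)^-1%g (hi i) in E2 *.
have uP : spct_word s P = lo i by rewrite permKV.
have uQ : spct_word s Q = hi i by rewrite permKV.
have ds k : run k -> rdesc k (spct_word s) by apply: word_desc.
have PQ : P != Q by rewrite (inj_eq perm_inj) -val_eqE /= neq_ltn leqnn.
rewrite /spct_act /descent; case: ifPn => [nd|].
  rewrite E1 E2 /weakly_right -ltnNge in nd.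
  rewrite lam_ldesc // ldescN -/P -/Q; apply/negP=> lt.
  (* Inside a run the word decreases; across a joint k outside the runs, [source_cover] would make
     the two labels consecutive in one run, though k separates them. *)
  have [rn|[k kpq nk]] := all_or_none run P Q.
    by have := run_desc ds lt rn; rewrite uP uQ /=; lia.
  have lt' := nonrun_lt kpq nk.
  have cov : val s (phi Q) = (val s (phi P)).+1 :> nat by rewrite -!spct_wordE uP uQ.
  rewrite !(pos_entry t_phi) in cov; rewrite !(pos_box t_phi) in nd.
  have [||e D] :=
    source_cover t_source (valP s) (class_std sE) (ltn0Sn (g P)) _ _ nd cov;
    rewrite ?ltnS //.
  have gk := seg_lt kpq (g_seg nk).
  by move: nk; rewrite /run_joint (_ : k.+1 = (g P).+1) ?D //; lia.
rewrite negbK E1 E2 /weakly_right => le.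
have label_PQ : P < Q -> g P < g Q.
  move=> lt; have [rn|[k kpq nk]] := all_or_none run P Q; last exact: nonrun_lt nk.
  by have := run_desc ds lt rn; rewrite uP uQ /=; lia.
(* If Q came first, the box of i + 1 would be strictly left of that of i inside a run, or [label_lt]
   would give i + 1 < i. *)
have lt : P < Q.
  rewrite ltnNge leq_eqVlt; apply/negP=> /predU1P[/ord_inj eq|lt].
    by rewrite eq eqxx in PQ.
  have [rn|[k kpq nk]] := all_or_none run Q P.
    have := nonsplice_col g_desc g_seg t_phi t_source lt.
    have ns k : Q <= k < P -> ~~ splice k.
      by move=> /rn; rewrite /splice_joint /run_joint => /negPf->.
    by move=> /(_ ns)/leq_trans/(_ le); rewrite leqNgt -[X in X < _]addn0 ltn_add2l subn_gt0 lt.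
  have := label_lt sE (nonrun_lt kpq nk) (or_introl le).
  by rewrite uP uQ /=; lia.
have lamE : lam i (spct_word s) = (spct_word s * tr i)%g by rewrite /lam -/P -/Q lt.
case: ifPn => [att s' sE'|natt].
  apply/eqP=> eq; have := label_lt sE' (label_PQ lt) (or_intror att).
  by rewrite eq lamE !permM uP uQ tr_lo tr_hi /=; lia.
have i_n : 0 < i.+1 < n by rewrite /= hi_subproof.
rewrite /spct_word val_insubd is_spct_swap ?(valP s) //; first last.
- by rewrite E1 E2.
- by rewrite E1 E2 -leqNgt.
by rewrite (word_of_swap phiK) //.
Qed.

(** Undoing an effective exchange can break only a relation on the exchanged pair. Such a pair would
    be inverted by g, hence lie in one run, where u has the required order. *)
Lemma class_word_lower i u s : admissible splice run u -> s \in val E ->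
  spct_word s = lam i u -> exists2 s', s' \in val E & spct_word s' = u.
Proof.
move=> /forallP au sE; have [d|nd] := boolP (ldesc i u).
  by rewrite lam_ldesc // => <-; exists s.
rewrite lam_nldesc // => eq; apply: class_fill => p q gpq rel.
have lt := class_rel sE gpq rel.
have Eu : u = (spct_word s * tr i)%g by rewrite eq -mulgA trK mulg1.
have [[sp sq]|ne] := altP ((spct_word s p, spct_word s q) =P (lo i, hi i)); last first.
  rewrite Eu !permM tr_lt //; apply: contraTneq lt => -[-> ->] /=.
  by rewrite -leqNgt leqnSn.
apply: word_lt_swap => // [k rk|]; first by have /andP[_ /implyP->] := au k.
move: nd; rewrite ldescN negbK.
have -> : (u^-1)%g (lo i) = q by rewrite Eu invM_tr tr_lo -sq permK.
by have -> : (u^-1)%g (hi i) = p by rewrite Eu invM_tr tr_hi -sp permK.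
Qed.

(** A violated relation at p < q leaves no splice between them, so columns increase strictly from p
    to q. Only an attacking pair in adjacent columns remains, with q = p + 1; but a run joint stays
    in one row, and an attacking pair at a descent is a splice. *)
Lemma class_word_seg u : admissible splice run u ->
  (forall k, splice k -> seg k u) -> exists2 s, s \in val E & spct_word s = u.
Proof.
move=> /forallP au useg; apply: class_fill => p q gpq rel.
have du k : run k -> rdesc k u by move=> rk; have /andP[_ /implyP->] := au k.
have [qp|pq|/ord_inj eq] := ltngtP q p; last by move: gpq; rewrite eq ltnn.
  exact: word_lt_swap.
rewrite ltnNge leq_eqVlt; apply/negP=> /predU1P[/ord_inj/perm_inj eq|lt].
  by move: pq; rewrite eq ltnn.
have ns k : p <= k < q -> ~~ splice k.
  by move=> kpq; apply/negP=> /useg/(seg_lt kpq); lia.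
have col := nonsplice_col g_desc g_seg t_phi t_source pq ns.
move: rel => /orP[/eqP eq|].
  by move: col; rewrite eq /= addSn ltnNge leq_addr.
rewrite {1}/attacking => /orP[/eqP e|/andP[/eqP e lt1]].
  by move: col; rewrite e -[X in _ <= X]addn0 leq_add2l leqn0 subn_eq0 leqNgt pq.
have [k [Ek le Elo]] := joint_before pq.
have qp1 : q - p <= 1 by move: col; rewrite e -[X in _ <= X]addn1 leq_add2l.
have Ep : lo k = p by apply: ord_inj; rewrite Elo; lia.
have := ns k; rewrite -Ep -Ek /= leqnn leqnn => /(_ isT).
have [rk|nk] := boolP (run k).
  by move: lt1; rewrite -Ep -Ek (run_box g_desc g_seg t_phi t_source rk) ltnn.
rewrite /splice_joint (mergesat_box g_desc g_seg t_phi nk).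
move: nk; rewrite negbK => -> /=.
by rewrite negb_or /attacking Ep Ek e lt1 eqxx orbT andbF.
Qed.

End ClassWords.

(** * The projective cover *)

Section SourceExists.
Variables (n : nat) (alpha : seq nat) (sigma : 'S_(size alpha)).
Variable E : spct_class n sigma.

Lemma class_nonempty : exists s, s \in val E.
Proof.
have /imsetP[x _ ->] := valP E; exists x.
by rewrite !inE /=; apply/forallP.
Qed.

Definition col_weight (f : filling (cd alpha) n) : nat :=
  \sum_b f b * (ssval b).2.

Lemma col_weight_swap i (f : filling (cd alpha) n) : 0 < i < n -> standard f ->
  (box_of f i.+1).2 < (box_of f i).2 -> col_weight f < col_weight (swap i f).
Proof.
move=> i_n sf lt.
have [b fb] := standard_onto sf (k := i) ltac:(lia).
have [c fc] := standard_onto sf (k := i.+1) ltac:(lia).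
rewrite (box_ofE sf fb) (box_ofE sf fc) in lt.
have cb : c != b by apply: contraTneq lt => ->; rewrite ltnn.
have split2 (h : seq_sub (cd alpha) -> nat) :
    \sum_d h d = h b + h c + \sum_(d | (d != b) && (d != c)) h d.
  by rewrite (bigD1 b) // (bigD1 c) //= addnA.
have i_n' : i < n by case/andP: i_n.
rewrite /col_weight !split2 !swapE // fb fc /nswap eqxx (gtn_eqF (ltnSn i)) eqxx.
rewrite [X in _ < _ + X](eq_bigr (fun d => f d * (ssval d).2)).
  rewrite ltn_add2r !mulSn; move: (ssval b).2 (ssval c).2 lt => x y lt; lia.
move=> d /andP[db dc]; rewrite swapE // /nswap.
have -> : f d == i :> nat = false.
  by apply/negbTE; apply: contra db => /eqP fd; apply/eqP/(standard_inj sf); rewrite fd.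
have -> // : f d == i.+1 :> nat = false.
by apply/negbTE; apply: contra dc => /eqP fd; apply/eqP/(standard_inj sf); rewrite fd.
Qed.

Hypothesis halpha : is_comp n alpha.

(* A tableau of maximal weight is a source: exchanging i and i + 1 at a       *)
(* violation would increase the weight.                                      *)
Lemma source_exists : exists2 t, t \in val E & is_source t.
Proof.
have [s0 s0E] := class_nonempty.
case: (arg_maxnP (fun s : spct n sigma => col_weight (val s)) s0E) => t tE tmax.
exists t => //; apply/allP=> i; rewrite mem_iota => i_in.
have i_n : 0 < i < n by lia.
apply/implyP=> iD; apply/negPn/negP=> nleft.
have st := spct_standard (valP t).
have lt : (box_of (val t) i.+1).2 < (box_of (val t) i).2.
  rewrite ltnNge; apply: contra iD => le.
  by rewrite mem_filter mem_iota i_in andbT.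
have [b fb] := standard_onto st (k := i) ltac:(lia).
have [c fc] := standard_onto st (k := i.+1) ltac:(lia).
have Eb := box_ofE st fb; have Ec := box_ofE st fc.
(* Since i + 1 is strictly but not immediately left of i, the exchanged pair is not among the
   relations that define the class. *)
have [|sp stdE] := spct_linext (valP t) (standard_swap i_n st).
  move=> b' c' ltbc rel; rewrite (lt_swap i_n st) //.
    apply: contraTneq rel => -[-> ->]; rewrite negb_or nleft /attacking negb_or.
    by rewrite (gtn_eqF lt) (ltn_eqF (leqW lt)).
  apply: contraTneq ltbc => -[]; rewrite Eb Ec => /val_inj-> /val_inj->.
  by rewrite fb fc -leqNgt leqnSn.
have /tmax : Sub _ sp \in val E.
  rewrite (class_equiv _ tE); apply/(spct_equivP halpha) => k.
  by rewrite SubK stdE.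
by rewrite SubK /= leqNgt col_weight_swap.
Qed.

End SourceExists.

Lemma eq_admissible n (I I' J J' : pred 'I_n.-1) u : I =1 I' -> J =1 J' ->
  admissible I J u = admissible I' J' u.
Proof. by move=> eI eJ; apply: eq_forallb => k; rewrite eI eJ. Qed.

Section Labels.
Variables (n : nat) (alpha : seq nat) (sigma : 'S_(size alpha)).
Variable t : spct n sigma.

Lemma labelling_exists (g : 'S_n) :
  exists (phi : 'I_n -> seq_sub (cd alpha)) (phi' : seq_sub (cd alpha) -> 'I_n),
    [/\ cancel phi phi', cancel phi' phi & forall p, val t (phi p) = (g p).+1 :> nat].
Proof.
have st := spct_standard (valP t).
have ex p : exists b, val t b == (g p).+1 :> nat.
  by have [|b bE] := standard_onto st (k := (g p).+1); rewrite ?ltn_ord //; exists b; apply/eqP.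
have lt b : (val t b).-1 < n.
  by have := ltn_ord (val t b); have := standard_gt0 b st; lia.
pose phi p := xchoose (ex p); pose phi' b := (g^-1)%g (Ordinal (lt b)).
have tphi p : val t (phi p) = (g p).+1 :> nat by apply/eqP/(xchooseP (ex p)).
exists phi, phi'; split=> // [p|b].
  by apply: (@perm_inj _ g); rewrite permKV; apply: val_inj; rewrite /= tphi.
apply: (standard_inj st); rewrite tphi permKV /= prednK //; exact: standard_gt0.
Qed.

Lemma run_w0_exists : exists2 g : 'S_n,
  forall k, run_joint t k -> rdesc k g & forall k, ~~ run_joint t k -> seg k g.
Proof.
have [ks Kks d] := w0_exists (run_joint t); exists (rword 1%g ks) => // k nk.
by apply: seg_rword (seg1 k); apply: contra nk => /(allP Kks).
Qed.

End Labels.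

(** * The epimorphism onto the class module *)

Section Cover.
Variables (K : fieldType) (n : nat) (alpha : seq nat) (sigma : 'S_(size alpha)).
Hypothesis halpha : is_comp n alpha.
Variables (E : spct_class n sigma) (t : spct n sigma).
Hypotheses (tE : t \in val E) (t_source : is_source t).
Local Notation A := (alpha_source t).
Local Notation H := (hecke K n).
Local Notation M := (spct_mod K n sigma).
Local Open Scope ring_scope.
Local Notation "c %:H" := ((c : K)%:A : H) (at level 1, format "c %:H").

Let szA : size (grd A) = n. Proof. by case: (alpha_source_joints t). Qed.
Let stA : sorted ribbon_step (grd A). Proof. exact: alpha_source_step. Qed.
Local Notation eA := (srt_word szA).
Local Notation adm := (admissible (splice_joint t) (run_joint t)).

Let admE u : admissible (@rowI n A) (@colJ n A) u = adm u.
Proof. exact/eq_admissible/alpha_source_colJ/alpha_source_rowI. Qed.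

Variable g : 'S_n.
Hypothesis g_desc : forall k, run_joint t k -> rdesc k g.
Hypothesis g_seg : forall k, ~~ run_joint t k -> seg k g.
Variables (phi : 'I_n -> seq_sub (cd alpha)) (phi' : seq_sub (cd alpha) -> 'I_n).
Hypotheses (phiK : cancel phi phi') (phiK' : cancel phi' phi).
Hypothesis t_phi : forall p, val t (phi p) = (g p).+1 :> nat.
Local Notation eE := (spct_word phi).

Definition class_vec (u : 'S_n) : M :=
  if [pick s in val E | eE s == u] is Some s then hbasis K (spct_hecke n sigma) s else 0.

Lemma class_vec_word s : s \in val E ->
  class_vec (eE s) = hbasis K (spct_hecke n sigma) s.
Proof.
move=> sE; rewrite /class_vec; case: pickP => [s' /andP[_ /eqP/(spct_word_inj phiK phiK')->]//|].
by move/(_ s); rewrite sE eqxx.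
Qed.

Lemma class_vec0 u : (forall s, s \in val E -> eE s != u) -> class_vec u = 0.
Proof.
move=> nu; rewrite /class_vec; case: pickP => // s /andP[sE su].
by have := nu s sE; rewrite su.
Qed.

Lemma class_vec_in u : class_vec u \in class_span E.
Proof.
rewrite /class_vec; case: pickP => [s /andP[sE _]|_]; apply/forallP=> s'; apply/implyP=> s'E.
  by rewrite ffunE; case: (s' =P s) s'E => [->|_ _ /=]; rewrite ?sE ?eqxx.
by rewrite ffunE eqxx.
Qed.

Lemma class_vec_at u s : s \in val E -> class_vec u s = (eE s == u)%:R.
Proof.
move=> sE; rewrite /class_vec; case: pickP => [s' /andP[s'E /eqP <-]|/(_ s)].
  by rewrite ffunE (inj_eq (spct_word_inj phiK phiK')).
by rewrite sE /= ffunE => ->.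
Qed.

Lemma hgen_class_vec i u : adm u -> hgen K i *: class_vec u = class_vec (lam i u).
Proof.
move=> au; have [/existsP[s /andP[sE /eqP su]]|/existsPn nex] :=
  boolP [exists s, (s \in val E) && (eE s == u)].
  have := class_word_act halpha tE t_source g_desc g_seg phiK t_phi i sE.
  rewrite -su class_vec_word // hgenE -[spct_hecke n sigma i s]/(spct_act i s).
  case Es: (spct_act i s) => [s'|]; last by move/class_vec0->.
  by move<-; rewrite class_vec_word // -(class_act _ Es).
have nu s : s \in val E -> eE s != u by move=> sE; have := nex s; rewrite sE.
rewrite (class_vec0 nu) scaler0 class_vec0 // => s sE; apply/eqP=> su.
have [s' s'E us'] :=
  class_word_lower halpha tE t_source g_seg phiK phiK' t_phi au sE su.
by have := nu s' s'E; rewrite us' eqxx.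
Qed.

Definition class_image (x : srt n A) : spct_class_mod K E :=
  SpctClassMod (class_vec_in (eA x)).

Lemma class_image_act i x : hgen K i *: class_image x =
  if srt_hecke n A i x is Some y then class_image y else 0.
Proof.
apply: val_inj; rewrite linearZ /= hgen_class_vec; last first.
  by rewrite -admE; apply: srt_word_adm.
have /= := srt_word_act szA stA i x; case: (srt_act i x) => [y <-//|nadm].
rewrite -[class_val 0]/(val (0 : spct_class_mod K E)) linear0.
apply: class_vec0 => s sE; apply: contra nadm => /eqP <-; rewrite admE.
exact: (class_adm halpha tE t_source g_desc g_seg phiK t_phi).
Qed.

Lemma srt_projective : projective (srt_mod n A K).
Proof.
exact: (word_projective (rowI_colJ szA stA) (srt_word_inj (sizeD := szA) stA)
  (srt_word_adm szA stA) (srt_word_onto szA stA) (srt_word_act szA stA)).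
Qed.

Lemma class_image_exists s : s \in val E -> exists x, eA x = eE s.
Proof.
move=> sE; apply: srt_word_onto => //; rewrite admE.
exact: (class_adm halpha tE t_source g_desc g_seg phiK t_phi).
Qed.

(** Surjectivity holds because all words of E are admissible. An admissible word avoiding the
    letters of I is the word of some s in E, and the coordinate of f v at s is that of v at this
    word, hence zero on the kernel. *)
Lemma srt_essential :
  exists f : {linear srt_mod n A K -> spct_class_mod K E}, essential_epi f.
Proof.
have [f fE] := span_hom class_image_act; exists f.
have e_inj := srt_word_inj (sizeD := szA) stA.
apply: (word_essential (rowI_colJ szA stA) e_inj (srt_word_adm szA stA)
  (srt_word_onto szA stA) (srt_word_act szA stA)) => [v|v fv0 x vx].
  exists (\sum_(s in val E) (val v s)%:H *: vec K (srt_hecke n A) eA (eE s)).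
  apply: val_inj; rewrite linear_sum linear_sum [RHS]span_decomp.
  rewrite [RHS](bigID (mem (val E))) /= [X in _ + X]big1 ?addr0 => [|s sE]; last first.
    have /forallP/(_ s) := valP v; rewrite sE => /eqP ->.
    by rewrite scale0r scale0r.
  apply: eq_bigr => s sE; have [x xs] := class_image_exists sE.
  by rewrite !linearZ /= -xs vec_e // fE span_fun_basis /= xs class_vec_word.
have [/existsP[k /andP[Ik nseg]]|/existsPn all_seg] :=
  boolP [exists k, rowI A k && ~~ seg k (eA x)]; first by exists k.
have [||s sE xs] := class_word_seg halpha tE t_source g_desc g_seg phiK phiK' t_phi (u := eA x).
- by rewrite -admE; apply: srt_word_adm.
- by move=> k; rewrite -alpha_source_rowI => Ik; have := all_seg k; rewrite Ik negbK.
have := congr1 (fun w : spct_class_mod K E => val w s) fv0; rewrite fE /span_fun linear_sum.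
rewrite sum_ffunE (bigD1 x) //= big1 => [|y /negPf yx].
  rewrite hscalarE /= class_vec_at // xs eqxx mulr1 addr0 ffunE => v0.
  by rewrite v0 eqxx in vx.
by rewrite hscalarE /= class_vec_at // xs (inj_eq e_inj) eq_sym yx mulr0.
Qed.

End Cover.

Theorem spct_projective_cover (K : fieldType) (n : nat) (alpha : seq nat)
    (sigma : 'S_(size alpha)) (halpha : is_comp n alpha) (E : spct_class n sigma) :
  projective_cover (srt_mod n (alpha_class E) K) (spct_class_mod K E).
Proof.
have [t0 t0E t0_source] := source_exists E halpha.
rewrite /alpha_class; case: pickP => [t /andP[tE t_source]|/(_ t0)]; last first.
  by rewrite t0E t0_source.
have [g g_desc g_seg] := run_w0_exists t.
have [phi [phi' [phiK phiK' t_phi]]] := labelling_exists t g.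
split; first exact: srt_projective.
exact: (srt_essential K halpha tE t_source g_desc g_seg phiK phiK' t_phi).
Qed.

Theorem theorem5p11 (R : realType) (n : nat) (alpha : seq nat)
    (sigma : 'S_(size alpha)) (halpha : is_comp n alpha)
    (hsigma : compatible sigma) (E : spct_class n sigma) :
  projective_cover (srt_mod n (alpha_class E) R[i]) (spct_class_mod R[i] E).
Proof. exact: spct_projective_cover. Qed.
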